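(* In the general single-commodity setting (finitely many sources with constant inflow rates, one sink) every equilibrium trajectory reaches steady state; that is, for every equilibrium trajectory $\ell:[0,\infty)\to\mathbb{R}^V$ there is $T\ge0$ such that $\ell'(\theta)=\lambda$ for every $\theta\ge T$ at which $\ell$ is differentiable, where $\lambda$ is the steady-state direction.
   Context: **Setting.** A finite directed graph $G=(V,E)$ with transit times $\tau_e\ge0$, capacities $\nu_e>0$, a set of sources $\mathcal{S}=\{s_1,\dots,s_m\}\subseteq V$ with inflow rates $u_i>0$, and a sink $t\in V\setminus\mathcal{S}$. (Multiple sinks, among which users are indifferent, are contracted to the single sink $t$.) Every node is reachable from some source and can reach $t$; there is no directed cycle of arcs of transit time $0$. Add a super-source $s\notin V$ and arcs $E_s=\{ss_i: s_i\in\mathcal{S}\}$; put $u_0=\sum_i u_i$. An arc from $v$ to $w$ is written $e=vw$. **Modified thin flows.** Given $E^*\subseteq E'\subseteq E$, consider pairs $(\ell',x')$ with $\ell'\in\mathbb{R}^V$, $x'\in\mathbb{R}_{\ge0}^{E\cup E_s}$ such that: $x'$ is a static $s$-$t$-flow of value $u_0$ supported on $E'\cup E_s$; $\ell'_{s_i}=x'_{ss_i}/u_i$ for all $s_i\in\mathcal{S}$; $\ell'_w\le\rho_e(\ell'_v,x'_e)$ for all $e=vw\in E'$; $\ell'_w=\rho_e(\ell'_v,x'_e)$ for all $e=vw\in E'$ with $x'_e>0$. Here $\rho_e(\ell'_v,x'_e)=x'_e/\nu_e$ if $e\in E^*$ and $\max\{\ell'_v,x'_e/\nu_e\}$ if $e\in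 E'\setminus E^*$. A maximal solution is one for which $\ell'$ is pointwise maximal among solutions. **Feasible labelings.** For $l\in\mathbb{R}^V$ let $E'_l=\{vw\in E: l_w-l_v\ge\tau_{vw}\}$ and $E^*_l=\{vw\in E: l_w-l_v>\tau_{vw}\}$. A source $s_i$ is active at $l$ if there is an $s_i$-$t$-path in $(V,E'_l)$. The labeling $l$ is feasible if: every node is reachable from some source in $(V,E'_l)$; every arc of $E^*_l$ lies on a path in $E'_l$ from a source to $t$; no arc of $E^*_l$ lies on a directed cycle in $(V,E'_l)$; and $l_{s_i}=0$ for every source $s_i$ that is not active at $l$. For feasible $l$, $X(l)$ denotes the (unique) label vector $\ell'$ of a maximal solution of the modified thin flow equations for $(E'_l,E^*_l)$. **Equilibrium trajectory.** A locally absolutely continuous $\ell:[0,\infty)\to\mathbb{R}^V$ with $\ell(\theta)$ feasible for all $\theta\ge 0$ and $\ell'(\theta)=X(\ell(\theta))$ for almost every $\theta$. **Steady-state direction.** $\lambda\in\mathbb{R}^V$ is the (unique) label vector of a maximal solution of the modified thin flow equations for $(E',E^* )=(E,\emptyset)$. (Equivalently: the restriction to $V$ of the steady-state direction of the single-source network $(V\cup\{s\},E\cup E_s)$ with source $s$, inflow $u_0$, arcs $ss_i$ of capacity $u_i$, all arcs $ss_i$ being treated as always resetting.) *)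

(* Defs.v *)
From mathcomp Require Import all_boot all_order all_algebra.
From mathcomp Require Import all_classical all_reals all_analysis.

Set Implicit Arguments.
Unset Strict Implicit.
Unset Printing Implicit Defensive.

Import Order.TTheory GRing.Theory Num.Theory.
Import numFieldNormedType.Exports.

Local Open Scope ring_scope.

(* Arcs form a type of their own, so parallel arcs are allowed. Only the values
   of [inflow] on [sources] are relevant. *)
Record network (R : realType) (V E : finType) := Network {
  src : E -> V;
  tgt : E -> V;
  transit : E -> R;
  capacity : E -> R;
  sources : {set V};
  inflow : V -> R;
  sink : V }.

Section Network.
Variables (R : realType) (V E : finType) (N : network R V E).
Implicit Types (A : {set E}) (e : E) (v w : V) (p : seq E).

Fixpoint walk A v p w : bool :=
  if p is e :: p' then [&& e \in A, src N e == v & walk A (tgt N e) p' w]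
  else v == w.

Definition dipath A v p w : bool :=
  walk A v p w && uniq (v :: map (tgt N) p).

Definition dicycle A p : Prop :=
  p != [::] /\ exists v, walk A v p v && uniq (map (tgt N) p).

Definition reachable A v w : Prop := exists p, dipath A v p w.

Record network_axioms : Prop := {
  transit_ge0 : forall e, 0 <= transit N e;
  capacity_gt0 : forall e, 0 < capacity N e;
  inflow_gt0 : forall v, v \in sources N -> 0 < inflow N v;
  sink_notin_sources : sink N \notin sources N;
  reachable_from_source :
    forall v, exists2 s, s \in sources N & reachable [set: E]%SET s v;
  reaches_sink : forall v, reachable [set: E]%SET v (sink N);
  no_zero_dicycle :
    forall p, ~ dicycle [set e | transit N e == 0]%SET p }.

(* The network extended by the super-source: nodes are [option V], with [None]
   the super-source, and [inr s] is the arc from it to the source [s]. *)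
Definition source : finType := {v : V | v \in sources N}.

Definition xarc : finType := (E + source)%type.

Definition xsrc (a : xarc) : option V :=
  match a with inl e => Some (src N e) | inr _ => None end.

Definition xtgt (a : xarc) : option V :=
  match a with inl e => Some (tgt N e) | inr s => Some (val s) end.

Definition total_inflow : R := \sum_(s in sources N) inflow N s.

Definition net_outflow (x : xarc -> R) (v : option V) : R :=
  \sum_(a | xsrc a == v) x a - \sum_(a | xtgt a == v) x a.

Definition static_flow (x : xarc -> R) (value : R) : Prop :=
  [/\ forall a, 0 <= x a,
      forall v : option V, v != None -> v != Some (sink N) ->
        net_outflow x v = 0
    & net_outflow x None = value].

Section ThinFlow.
Variables E' Estar : {set E}.

Definition rho e (lv xe : R) : R :=
  if e \in Estar then xe / capacity N e
  else Num.max lv (xe / capacity N e).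

Record thin_flow (l' : V -> R) (x' : xarc -> R) : Prop := {
  thin_flow_static : static_flow x' total_inflow;
  thin_flow_support : forall e, e \notin E' -> x' (inl e) = 0;
  thin_flow_source :
    forall s : source, l' (val s) = x' (inr s) / inflow N (val s);
  thin_flow_le : forall e, e \in E' ->
    l' (tgt N e) <= rho e (l' (src N e)) (x' (inl e));
  thin_flow_eq : forall e, e \in E' -> 0 < x' (inl e) ->
    l' (tgt N e) = rho e (l' (src N e)) (x' (inl e)) }.

Definition maximal_label (l' : V -> R) : Prop :=
  (exists x', thin_flow l' x') /\
  forall k' y', thin_flow k' y' -> forall v, k' v <= l' v.

End ThinFlow.

Definition active_arcs (l : V -> R) : {set E} :=
  [set e | transit N e <= l (tgt N e) - l (src N e)]%SET.

Definition resetting_arcs (l : V -> R) : {set E} :=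
  [set e | transit N e < l (tgt N e) - l (src N e)]%SET.

Definition active_source (l : V -> R) (s : V) : Prop :=
  reachable (active_arcs l) s (sink N).

Record feasible (l : V -> R) : Prop := {
  feasible_reachable :
    forall v, exists2 s, s \in sources N & reachable (active_arcs l) s v;
  feasible_resetting_path : forall e, e \in resetting_arcs l ->
    exists2 s, s \in sources N &
      exists2 p, dipath (active_arcs l) s p (sink N) & e \in p;
  feasible_resetting_acyclic : forall e, e \in resetting_arcs l ->
    forall p, dicycle (active_arcs l) p -> e \notin p;
  feasible_inactive : forall s, s \in sources N ->
    ~ active_source l s -> l s = 0 }.

(* The graph of X: [thin_direction l l'] means that X(l) = l'. *)
Definition thin_direction (l l' : V -> R) : Prop :=
  maximal_label (active_arcs l) (resetting_arcs l) l'.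

Definition steady_state_direction (lam : V -> R) : Prop :=
  maximal_label [set: E]%SET finset.set0 lam.

End Network.

Section Trajectory.
Variable R : realType.

(* The [n] intervals are the open intervals between [a i] and [b i]. *)
Definition absolutely_continuous (f : R -> R) (c d : R) : Prop :=
  forall eps : R, 0 < eps -> exists2 delta : R, 0 < delta &
    forall (n : nat) (a b : 'I_n -> R),
      (forall i, [/\ c <= a i, a i <= b i & b i <= d]) ->
      trivIset setT (fun i => `]a i, b i[%classic) ->
      \sum_i (b i - a i) < delta ->
      \sum_i `|f (b i) - f (a i)| < eps.

Variables (V E : finType) (N : network R V E).

(* Labels at negative times are irrelevant. *)
Record equilibrium_trajectory (ell : R -> V -> R) : Prop := {
  trajectory_ac :
    forall v (d : R), 0 <= d -> absolutely_continuous (ell^~ v) 0 d;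
  trajectory_feasible : forall theta, 0 <= theta -> feasible N (ell theta);
  trajectory_direction :
    {ae @lebesgue_measure R, forall theta : R, 0 <= theta ->
      (forall v, derivable (ell^~ v) theta 1) /\
      thin_direction N (ell theta) (fun v => derive1 (ell^~ v) theta)} }.

End Trajectory.

(* Main.v *)
(** Let [lam] be the steady-state direction.  For [n : V -> R] put
    [g n c = sum_e nu_e n_w (c_w - c_v)^+ + sum_s u_s n_s c_s - u_0 c_t]
    ([cut_functional]).
    A flow of value [u_0] of rates at most [nu_e n_w] makes [g n] nonnegative,
    and [lam] is the only such [n] with [g n n = 0] (apart from a condition that
    pins down the nodes without flow), because [n] then minimises the convex
    function [g n].

    Two Lyapunov functions are used.  The energy
    [sum_e nu_e l_w q_e + sum_s u_s l_s^2 - u_0 theta l_t], where [q_e] is the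
    queueing delay, is [theta^2 g(n, n)] up to lower order for [n = l / theta].  It
    grows like [theta log theta] only, so every accumulation point [m] of [n]
    satisfies [g m m = 0]: hence [l / theta] tends to [lam], and from some time
    on an arc along which [lam] decreases is inactive.  From then on the potential
    [u_0 l_t - sum_s u_s lam_s l_s - sum_e nu_e lam_w q_e], which is bounded
    above by linear programming duality, is nondecreasing.  Its derivative takes
    finitely many values and vanishes only at a labeling where [X(l) = lam] and
    the potential is maximal; such a labeling is therefore reached, and from then on
    the potential is constant, so [X(l) = lam] for ever.

    The derivatives of both functions are estimated by one inequality
    ([master_inequality], with [n = l / theta] and [n = lam] respectively). *)
Require Import Defs.
From mathcomp Require Import all_boot all_order all_algebra.
From mathcomp Require Import all_classical all_reals all_analysis.
From mathcomp Require Import measurable_realfun ring lra.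
Import Order.TTheory GRing.Theory Num.Theory.
Import numFieldNormedType.Exports.
Local Open Scope ring_scope.

Set Implicit Arguments.
Unset Strict Implicit.
Unset Printing Implicit Defensive.

(** * Monotonicity from an almost everywhere one-sided derivative *)

Section RightDerivative.
Local Open Scope classical_set_scope.
Variable R : realType.
Implicit Types (f g : R -> R) (x a b d : R).

(** One-sided derivatives suffice for monotonicity and, unlike two-sided ones, always survive taking
    positive parts. Queueing delays are positive parts of label differences. *)
Definition right_derivative f x d : Prop :=
  (fun h => h^-1 * (f (x + h) - f x)) @ 0^'+ --> d.

Lemma right_derivative_le f x d eps : right_derivative f x d -> d < eps ->
  exists2 r, 0 < r & forall y, x < y -> y < x + r -> f y - f x <= eps * (y - x).
Proof.
move=> fxd deps.
have : \forall h \near 0^'+, h^-1 * (f (x + h) - f x) <= eps.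
  by apply: (cvgr_le d).
case => r /= r0 Hr; exists r => // y xy yr.
have h0 : 0 < y - x by rewrite subr_gt0.
have := Hr (y - x); rewrite /= sub0r normrN gtr0_norm// => /(_ _ h0).
rewrite [x + _]addrC subrK => H.
have {}H : (y - x)^-1 * (f y - f x) <= eps by apply: H; lra.
by rewrite -ler_pdivrMr// mulrC.
Qed.

(** Additivity of the measure on disjoint intervals; this connects the measure of [U] with the
    [delta] of absolute continuity. *)
Lemma sum_length_le (U : set R) n (u v : 'I_n -> R) : open U ->
  (forall i, u i <= v i) -> (forall i, `]u i, v i[ `<=` U) ->
  trivIset setT (fun i => `]u i, v i[) ->
  ((\sum_i (v i - u i))%:E <= lebesgue_measure U)%E.
Proof.
move=> oU uv sub triv.
have -> : (\sum_i (v i - u i))%:E = (\sum_(i < n) @lebesgue_measure R `]u i, v i[)%E.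
  rewrite -sumEFin; apply: eq_bigr => i _.
  rewrite lebesgue_measure_itv /= lte_fin.
  case: ltgtP (uv i) => // ->; by rewrite subrr.
have mI i : measurable (`]u i, v i[ : set R) by exact: measurable_itv.
have <- : lebesgue_measure (\big[setU/set0]_(i < n) (`]u i, v i[ : set R))
    = (\sum_(i < n) @lebesgue_measure R `]u i, v i[)%E.
  by rewrite measure_bigsetU_ord.
apply: le_measure; rewrite ?inE.
- by apply: bigsetU_measurable => i _; exact: measurable_itv.
- exact: open_measurable.
- rewrite -bigcup_seq; exact: bigcup_sub.
Qed.

Lemma negligible_open_cover (N : set R) (delta : R) : 0 < delta ->
  lebesgue_measure.-negligible N ->
  exists U : set R, [/\ open U, N `<=` U & (lebesgue_measure U < delta%:E)%E].
Proof.
move=> d0 [A [mA A0 NA]].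
have Afin : (@lebesgue_measure R A < +oo)%E by rewrite [X in (X < _)%E]A0.
have [U [oU AU Ud]] := lebesgue_regularity_outer mA Afin d0.
exists U; split => //; first exact: subset_trans AU.
have mU := open_measurable oU.
rewrite -(setDUK AU) measureU//; last 2 first.
- exact: measurableD.
- by rewrite setDIK.
by rewrite [X in (X + _)%E]A0 add0e.
Qed.

(* Cover the exceptional null set by an open set on which [f] varies by at most
   [eps].  Outside it [f] grows at rate at most [eps], by real induction; the slack
   [eta] in [good] makes that property pass to suprema. *)
Lemma ac_nonincreasing f a b : 0 <= a -> a <= b ->
  absolutely_continuous f 0 b ->
  {ae lebesgue_measure, forall x, a <= x < b ->
     exists2 d, right_derivative f x d & d <= 0} ->
  f b <= f a.
Proof.
move=> a0 ab acf dnull.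
apply/ler_addgt0Pr => eps0 eps00.
(* The error has three parts: slope [eps] over a length of at most [b - a], variation [eps] inside
   [U], and slack [eta = eps] at the end point. *)
pose eps := eps0 / (b - a + 2).
have eps_gt0 : 0 < eps by rewrite divr_gt0//; lra.
have epsE : eps * (b - a) + eps + eps = eps0.
  by rewrite /eps; field; lra.
have [delta d0 Hd] := acf _ eps_gt0.
have [U [oU NU Ud]] := negligible_open_cover d0 dnull.
pose fam x n (u v : 'I_n -> R) :=
  [/\ forall i, [/\ a <= u i, u i <= v i & v i <= x],
      forall i, `]u i, v i[ `<=` U & trivIset setT (fun i => `]u i, v i[)].
pose good x eta := exists n (u v : 'I_n -> R), fam x n u v /\
  f x - f a <= eps * (x - a) + \sum_i `|f (v i) - f (u i)| + eta.
pose S : set R := fun x => a <= x <= b /\ (forall eta, 0 < eta -> good x eta).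
have Sa : S a.
  split; first by rewrite lexx.
  move=> eta eta0; exists 0%N, (fun=> 0), (fun=> 0); split.
    by split; case.
  by rewrite big_ord0; lra.
have supS : has_sup S.
  by split; [exists a | exists b => x [/andP[]]].
pose c := sup S.
have ac : a <= c by exact: sup_upper_bound.
have cb : c <= b by apply: ge_sup => [|x [/andP[]]//]; exists a.
have famW x y n u v : x <= y -> fam x n u v -> fam y n u v.
  by move=> xy [H1 H2 H3]; split => // i; have [? ? h] := H1 i; split => //; exact: le_trans xy.
have Sc : S c.
  split; first by rewrite ac cb.
  move=> eta eta0.
  have eta20 : 0 < eta / 2 by lra.
  have [del del0 Hdel] := acf _ eta20.
  have [y Sy yc] := sup_adherent del0 supS.
  have ycle : y <= c by exact: sup_upper_bound.
  have [/andP[ay yb] /(_ _ eta20) [n [u [v [F Fle]]]]] := Sy.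
  exists n, u, v; split; first exact: famW F.
  have : f c - f y < eta / 2.
    have := Hdel 1%N (fun=> y) (fun=> c); rewrite !big_ord1 => H.
    apply: le_lt_trans (ler_norm _) _; apply: H => [i| |]; first by split; lra.
    - by move=> i j _ _ _; rewrite (ord1 i) (ord1 j).
    - by rewrite -/c in yc; lra.
  have : eps * (y - a) <= eps * (c - a) by rewrite ler_pM2l//; lra.
  by lra.
(* Once the supremum is [b], the chosen intervals have total length below [delta], so [f] varies by
   less than [eps] on them. *)
have [cltb|] := ltP c b; last first.
  move=> bc; have cE : c = b by lra.
  have [_ /(_ _ eps_gt0) [n [u [v [[F1 F2 F3]]]]]] := Sc; rewrite cE => Fle.
  have sm : \sum_i (v i - u i) < delta.
    rewrite -lte_fin; apply: le_lt_trans Ud; apply: sum_length_le => // i.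
    by have [] := F1 i.
  have := Hd n u v _ F3 sm => H.
  have {}H : \sum_i `|f (v i) - f (u i)| < eps.
    by apply: H => i; have [h1 h2 h3] := F1 i; split => //;
      [exact: le_trans h1|exact: le_trans h3 cb].
  by lra.
suff [y [cy yb Sy]] : exists y, [/\ c < y, y <= b & S y].
  by have := sup_upper_bound supS Sy; rewrite -/c; lra.
have [_ Hc] := Sc.
(* Inside [U] the family is extended by the interval from [c] to [y], which pays for the whole
   increment of [f]. *)
have [cU|cU] := pselect (U c).
  have [r /= r0 Hr] : nbhs c U by exact: open_nbhs_nbhs.
  pose y := Num.min b (c + r / 2).
  have cy : c < y by rewrite lt_min cltb/=; lra.
  have yb : y <= b by rewrite ge_min lexx.
  have yr : y <= c + r / 2 by rewrite ge_min lexx orbT.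
  exists y; split => //; split; first by rewrite yb (le_trans ac (ltW cy)).
  move=> eta /Hc [n [u [v [[F1 F2 F3] Fle]]]].
  pose u' (i : 'I_n.+1) := if unlift ord_max i is Some j then u j else c.
  pose v' (i : 'I_n.+1) := if unlift ord_max i is Some j then v j else y.
  exists n.+1, u', v'; split; last first.
    rewrite big_ord_recr/= /u' /v' unlift_none.
    under eq_bigr => i _.
      have -> : widen_ord (leqnSn n) i = lift ord_max i.
        by apply: val_inj; rewrite /= /bump leqNgt ltn_ord.
      rewrite liftK; over.
    have := ler_norm (f y - f c).
    have : eps * (c - a) <= eps * (y - a) by rewrite ler_pM2l//; lra.
    by lra.
  split.
  - move=> i; rewrite /u' /v'; case: unliftP => [j _|_]; last by split; lra.
    by have [h1 h2 h3] := F1 j; split => //; exact: le_trans h3 (ltW cy).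
  - move=> i; rewrite /u' /v'; case: unliftP => [j _|_]; first exact: F2.
    move=> z /=; rewrite in_itv /= => /andP[cz zy]; apply: Hr => /=.
    by rewrite ltr_distlC; apply/andP; split; lra.
  - move=> i j _ _; rewrite /u' /v'.
    case: unliftP => [i' ->|->]; case: unliftP => [j' ->|->] //.
    + by move/F3 => ->.
    + move=> [z [/=]]; rewrite !in_itv/= => /andP[? ?] /andP[? ?].
      by have [? ? ?] := F1 i'; exfalso; lra.
    + move=> [z [/=]]; rewrite !in_itv/= => /andP[? ?] /andP[? ?].
      by have [? ? ?] := F1 j'; exfalso; lra.
(* Outside [U] the derivative condition holds at [c], and the slope [eps] pays for the increment;
   the family stays the same. *)
have [d fd d_le0] : exists2 d, right_derivative f c d & d <= 0.
  apply: contrapT => H; apply: cU; apply: NU => /= /(_ _)/H; apply.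
  by rewrite ac.
have [|r r0 Hr] := right_derivative_le (eps := eps) fd; first by lra.
pose y := Num.min b (c + r / 2).
have cy : c < y by rewrite lt_min cltb/=; lra.
have yb : y <= b by rewrite ge_min lexx.
have yr : y <= c + r / 2 by rewrite ge_min lexx orbT.
exists y; split => //; split; first by rewrite yb (le_trans ac (ltW cy)).
move=> eta /Hc [n [u [v [F Fle]]]]; exists n, u, v; split.
  by apply: famW F; lra.
have : f y - f c <= eps * (y - c) by apply: Hr => //; lra.
have : eps * (y - a) = eps * (y - c) + eps * (c - a) by ring.
by lra.
Qed.

End RightDerivative.

(** * Calculus of right derivatives *)

Section RightDerivativeRules.
Local Open Scope classical_set_scope.
Variable R : realType.
Implicit Types (f g : R -> R) (x a b d c : R).

Lemma right_derivative_near f g x d : f x = g x ->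
  (\forall h \near 0^'+, f (x + h) = g (x + h)) ->
  right_derivative f x d -> right_derivative g x d.
Proof.
move=> fg nfg; apply: cvg_trans; apply: near_eq_cvg.
by near do rewrite -fg; apply: filterS nfg => h ->.
Unshelve. all: by end_near. Qed.

Lemma right_derivative_ext f g x d : right_derivative f x d -> f =1 g ->
  right_derivative g x d.
Proof. by move=> fd /funext <-. Qed.

Lemma right_derivative_cst c x : right_derivative (fun=> c) x 0.
Proof.
rewrite /right_derivative; under eq_fun do rewrite subrr mulr0.
exact: cvg_cst.
Qed.

Lemma right_derivativeD f g x d c : right_derivative f x d ->
  right_derivative g x c -> right_derivative (fun y => f y + g y) x (d + c).
Proof.
move=> fd gc; rewrite /right_derivative.
under eq_fun do rewrite opprD addrACA mulrDr.
exact: cvgD.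
Qed.

Lemma right_derivative_continuous f x d : right_derivative f x d ->
  (fun h => f (x + h)) @ 0^'+ --> f x.
Proof.
move=> fd.
have : (fun h => h * (h^-1 * (f (x + h) - f x)) + f x) @ (0:R)^'+ --> 0 * d + f x.
  apply: cvgD; last exact: cvg_cst.
  by apply: cvgM => //; apply: cvg_at_right_filter; exact: cvg_id.
rewrite mul0r add0r; apply: cvg_trans; apply: near_eq_cvg.
near=> h; rewrite mulrA divff ?mul1r ?subrK//.
Unshelve. all: by end_near. Qed.

Lemma right_derivativeM f g x d c : right_derivative f x d ->
  right_derivative g x c ->
  right_derivative (fun y => f y * g y) x (d * g x + f x * c).
Proof.
move=> fd gc; rewrite /right_derivative.
have -> : (fun h => h^-1 * (f (x + h) * g (x + h) - f x * g x)) =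
  (fun h => (h^-1 * (f (x + h) - f x)) * g (x + h)
            + f x * (h^-1 * (g (x + h) - g x))).
  by apply/funext => h; ring.
apply: cvgD; apply: cvgM => //; last exact: cvg_cst.
exact: right_derivative_continuous gc.
Qed.

Lemma right_derivativeZ f x d c : right_derivative f x d ->
  right_derivative (fun y => c * f y) x (c * d).
Proof.
move=> fd; have := right_derivativeM (right_derivative_cst c x) fd.
by rewrite mul0r add0r.
Qed.

Lemma right_derivativeN f x d : right_derivative f x d ->
  right_derivative (fun y => - f y) x (- d).
Proof.
move=> fd; have -> : - d = -1 * d by rewrite mulN1r.
apply: right_derivative_ext (right_derivativeZ (c := -1) fd) _ => y.
by rewrite mulN1r.
Qed.

Lemma right_derivativeB f g x d c : right_derivative f x d ->
  right_derivative g x c -> right_derivative (fun y => f y - g y) x (d - c).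
Proof. by move=> fd /right_derivativeN; exact: right_derivativeD. Qed.

Lemma right_derivative_sum (I : finType) (F : I -> R -> R) (D : I -> R) x :
  (forall i, right_derivative (F i) x (D i)) ->
  right_derivative (fun y => \sum_i F i y) x (\sum_i D i).
Proof.
move=> FD; elim: (index_enum I) => [|i s IH].
  rewrite big_nil; apply: right_derivative_ext (right_derivative_cst 0 x) _ => y.
  by rewrite big_nil.
rewrite big_cons; apply: right_derivative_ext (right_derivativeD (FD i) IH) _ => y.
by rewrite big_cons.
Qed.

(** The right derivative of the positive part of a function with value [y] and right derivative [d];
    at the kink only an upward motion counts. *)
Definition pos_right_derivative (y d : R) : R :=
  if 0 < y then d else if y == 0 then Num.max d 0 else 0.

Lemma right_derivative_pos f x d : right_derivative f x d ->
  right_derivative (fun y => Num.max (f y) 0) x (pos_right_derivative (f x) d).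
Proof.
move=> fd; have fc := right_derivative_continuous fd.
rewrite /pos_right_derivative; case: ltgtP => [fx0|fx0|fx0].
- apply: right_derivative_near fd; first by rewrite max_l// ltW.
  have : \forall h \near 0^'+, 0 < f (x + h) by exact: (cvgr_gt (f x)).
  by apply: filterS => h hh; rewrite max_l// ltW.
- apply: right_derivative_near (right_derivative_cst 0 x).
    by rewrite max_r// ltW.
  have : \forall h \near 0^'+, f (x + h) < 0 by exact: (cvgr_lt (f x)).
  by apply: filterS => h hh; rewrite max_r// ltW.
have : (fun h => Num.max (h^-1 * (f (x + h) - f x)) 0) @ (0:R)^'+ --> Num.max d 0.
  have mc : (fun y : R => Num.max y 0) @ d --> Num.max d 0.
    by apply: (@continuous_max R R id (cst 0)); [exact: cvg_id|exact: cvg_cst].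
  exact: cvg_comp fd mc.
apply: cvg_trans; apply: near_eq_cvg; near=> h.
rewrite -fx0 maxxx !subr0 maxr_pMr ?mulr0// invr_ge0 ltW//.
Unshelve. all: by end_near. Qed.

Lemma right_derivative_id x : right_derivative id x 1.
Proof.
have : (fun=> 1 : R) @ (0:R)^'+ --> (1:R) by exact: cvg_cst.
apply: cvg_trans; apply: near_eq_cvg; near=> h.
by rewrite /= addrAC subrr add0r mulVf.
Unshelve. all: by end_near. Qed.

Lemma derivable_right_derivative f x : derivable f x 1 ->
  right_derivative f x (derive1 f x).
Proof.
move=> fx; rewrite derive1E /right_derivative.
have : (fun h : R => h^-1 *: (f (h *: 1 + x) - f x)) @ 0^'+ --> 'D_1 f x.
  apply: cvg_trans fx; apply: cvg_app => A [r /= r0 rA].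
  by exists r => // y yr y0; apply: rA => //; rewrite gt_eqF.
suff -> : (fun h : R => h^-1 *: (f (h *: 1 + x) - f x)) =
  (fun h => h^-1 * (f (x + h) - f x)) by [].
by apply/funext => h; rewrite [h *: 1]mulr1 [h + x]addrC.
Qed.

End RightDerivativeRules.

(** * Locally Lipschitz functions and their monotonicity *)

Section LocallyLipschitz.
Local Open Scope classical_set_scope.
Variable R : realType.
Implicit Types (f g : R -> R) (x y a b c d : R).

(** This class contains the labels of a trajectory, implies absolute continuity, and has short
    closure proofs for products and positive parts, from which the Lyapunov functions are built. *)
Definition locally_lipschitz f : Prop := forall b, 0 <= b ->
  exists2 L, 0 <= L & forall x y, 0 <= x -> x <= y -> y <= b ->
    `|f y - f x| <= L * (y - x).

Lemma locally_lipschitz_bounded f : locally_lipschitz f -> forall b, 0 <= b ->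
  exists2 B, 0 <= B & forall x, 0 <= x -> x <= b -> `|f x| <= B.
Proof.
move=> fl b b0; have [L L0 HL] := fl _ b0.
exists (`|f 0| + L * b) => [|x x0 xb].
  by rewrite addr_ge0// mulr_ge0.
have := HL 0 x (lexx _) x0 xb; rewrite subr0 => H.
have -> : f x = f 0 + (f x - f 0) by ring.
apply: le_trans (ler_normD _ _) _; rewrite lerD2l (le_trans H)//.
exact: ler_wpM2l.
Qed.

Lemma locally_lipschitz_cst c : locally_lipschitz (fun=> c).
Proof. by move=> b b0; exists 0 => // x y *; rewrite subrr normr0 mul0r. Qed.

Lemma locally_lipschitz_id : locally_lipschitz id.
Proof.
by move=> b b0; exists 1 => // x y x0 xy yb; rewrite mul1r ger0_norm ?subr_ge0.
Qed.

Lemma locally_lipschitzD f g : locally_lipschitz f -> locally_lipschitz g ->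
  locally_lipschitz (fun x => f x + g x).
Proof.
move=> fl gl b b0; have [L L0 HL] := fl _ b0; have [K K0 HK] := gl _ b0.
exists (L + K) => [|x y x0 xy yb]; first exact: addr_ge0.
rewrite opprD addrACA mulrDl; apply: le_trans (ler_normD _ _) _.
by rewrite lerD ?HL ?HK.
Qed.

Lemma locally_lipschitzM f g : locally_lipschitz f -> locally_lipschitz g ->
  locally_lipschitz (fun x => f x * g x).
Proof.
move=> fl gl b b0; have [L L0 HL] := fl _ b0; have [K K0 HK] := gl _ b0.
have [B B0 HB] := locally_lipschitz_bounded fl b0.
have [D D0 HD] := locally_lipschitz_bounded gl b0.
exists (L * D + B * K) => [|x y x0 xy yb]; first by rewrite addr_ge0 ?mulr_ge0.
have -> : f y * g y - f x * g x = (f y - f x) * g y + f x * (g y - g x) by ring.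
apply: le_trans (ler_normD _ _) _; rewrite !normrM mulrDl lerD//.
  rewrite -mulrA [D * _]mulrC mulrA ler_pM ?HL// HD//; exact: le_trans xy.
rewrite -mulrA ler_pM ?HK// HB//; exact: le_trans yb.
Qed.

Lemma locally_lipschitzZ f c : locally_lipschitz f ->
  locally_lipschitz (fun x => c * f x).
Proof. exact: locally_lipschitzM (locally_lipschitz_cst c). Qed.

Lemma locally_lipschitzN f : locally_lipschitz f ->
  locally_lipschitz (fun x => - f x).
Proof.
move=> fl b /fl[L L0 HL]; exists L => // x y x0 xy yb.
by rewrite -opprD normrN HL.
Qed.

Lemma locally_lipschitzB f g : locally_lipschitz f -> locally_lipschitz g ->
  locally_lipschitz (fun x => f x - g x).
Proof. by move=> fl /locally_lipschitzN; exact: locally_lipschitzD. Qed.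

Lemma locally_lipschitz_pos f : locally_lipschitz f ->
  locally_lipschitz (fun x => Num.max (f x) 0).
Proof.
move=> fl b /fl[L L0 HL]; exists L => // x y x0 xy yb.
apply: le_trans (HL _ _ x0 xy yb).
have := ler_norm (f y - f x); have := ler_norm (f x - f y).
rewrite [`|f x - f y|]distrC ler_norml => ? ?.
by apply/andP; split; case: (leP (f y) 0) => ?; case: (leP (f x) 0) => ?; lra.
Qed.

Lemma locally_lipschitz_sum (I : finType) (F : I -> R -> R) :
  (forall i, locally_lipschitz (F i)) ->
  locally_lipschitz (fun x => \sum_i F i x).
Proof.
move=> Fl; elim: (index_enum I) => [|i s IH].
  have -> : (fun x => \sum_(i <- [::]) F i x) = fun=> 0.
    by apply/funext => x; rewrite big_nil.
  exact: locally_lipschitz_cst.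
have -> : (fun x => \sum_(j <- i :: s) F j x) =
          (fun x => F i x + \sum_(j <- s) F j x).
  by apply/funext => x; rewrite big_cons.
exact: locally_lipschitzD.
Qed.

Lemma locally_lipschitz_inv1D : locally_lipschitz (fun x => (x + 1)^-1).
Proof.
move=> b b0; exists 1 => // x y x0 xy yb.
have -> : (y + 1)^-1 - (x + 1)^-1 = - ((y - x) * ((y + 1) * (x + 1))^-1).
  by field; apply/andP; split; lra.
have H : 1 <= (y + 1) * (x + 1) by nra.
rewrite normrN ger0_norm; last by rewrite mulr_ge0 ?subr_ge0// invr_ge0; lra.
rewrite mul1r ler_piMr ?subr_ge0// invf_le1//; lra.
Qed.

Lemma ln_leB1 x : 0 < x -> ln x <= x - 1.
Proof.
move=> x0; have := @le_ln1Dx R (x - 1); rewrite addrCA subrr addr0; apply; lra.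
Qed.

Lemma locally_lipschitz_ln1D : locally_lipschitz (fun x => ln (x + 1)).
Proof.
move=> b b0; exists 1 => // x y x0 xy yb.
have x1 : 0 < x + 1 by lra.
have y1 : 0 < y + 1 by lra.
rewrite -ln_div ?posrE//; rewrite ger0_norm; last first.
  by rewrite ln_ge0// ler_pdivlMr//; lra.
apply: le_trans (ln_leB1 _) _; first exact: divr_gt0.
have -> : (y + 1) / (x + 1) - 1 = (y - x) / (x + 1) by field; lra.
by rewrite mul1r ler_pdivrMr// ler_peMr; lra.
Qed.

Lemma locally_lipschitz_ac f b : 0 <= b -> locally_lipschitz f ->
  absolutely_continuous f 0 b.
Proof.
move=> b0 /(_ _ b0)[L L0 HL] eps eps0.
have L1 : 0 < L + 1 by lra.
exists (eps / (L + 1)); first exact: divr_gt0.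
move=> n u v uv _; rewrite ltr_pdivlMr// => sm.
have s0 : 0 <= \sum_i (v i - u i).
  by apply: sumr_ge0 => i _; have [? ? ?] := uv i; rewrite subr_ge0.
apply: (@le_lt_trans _ _ (L * \sum_i (v i - u i))); last by lra.
rewrite mulr_sumr; apply: ler_sum => i _; have [? ? ?] := uv i.
by apply: HL.
Qed.

Lemma ac_affine f s c b : absolutely_continuous f 0 b ->
  absolutely_continuous (fun x => s * f x + c * x) 0 b.
Proof.
move=> fac eps eps0; pose A := `|s| + 1; pose D := `|c| + 1.
have A0 : 0 < A by rewrite ltr_wpDl.
have D0 : 0 < D by rewrite ltr_wpDl.
have [|del del0 Hdel] := fac (eps / 2 / A); first by rewrite !divr_gt0.
exists (Num.min del (eps / 2 / D)); first by rewrite lt_min del0 !divr_gt0.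
move=> n u v uv tr; rewrite lt_min => /andP[/(Hdel _ _ _ uv tr) H1 H2].
have {}H1 : A * \sum_i `|f (v i) - f (u i)| < eps / 2.
  by rewrite mulrC -ltr_pdivlMr.
have {}H2 : D * \sum_i (v i - u i) < eps / 2 by rewrite mulrC -ltr_pdivlMr.
apply: (@le_lt_trans _ _ (A * (\sum_i `|f (v i) - f (u i)|)
                          + D * (\sum_i (v i - u i)))); last by lra.
rewrite !mulr_sumr -big_split/=; apply: ler_sum => i _.
have [? ? ?] := uv i.
have -> : s * f (v i) + c * v i - (s * f (u i) + c * u i) =
  s * (f (v i) - f (u i)) + c * (v i - u i) by ring.
apply: le_trans (ler_normD _ _) _; rewrite !normrM; apply: lerD.
  by apply: ler_wpM2r => //; rewrite lerDl.
have vu : 0 <= v i - u i by rewrite subr_ge0.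
by rewrite (ger0_norm vu); apply: ler_wpM2r => //; rewrite lerDl.
Qed.

Lemma ae_imply (P Q : R -> Prop) : (forall x, P x -> Q x) ->
  {ae @lebesgue_measure R, forall x, P x} ->
  {ae @lebesgue_measure R, forall x, Q x}.
Proof. by move=> PQ; apply: negligibleS => x /=; apply: contra_not; exact: PQ. Qed.

Lemma locally_lipschitz_nonincreasing f a : locally_lipschitz f -> 0 <= a ->
  {ae lebesgue_measure, forall x, a <= x ->
     exists2 d, right_derivative f x d & d <= 0} ->
  forall x y, a <= x -> x <= y -> f y <= f x.
Proof.
move=> fl a0 fae x y ax xy; apply: ac_nonincreasing => //; first lra.
  by apply: locally_lipschitz_ac => //; lra.
by apply: ae_imply fae => z Hz /andP[xz _]; apply: Hz; lra.
Qed.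

Lemma locally_lipschitz_nondecreasing f a : locally_lipschitz f -> 0 <= a ->
  {ae lebesgue_measure, forall x, a <= x ->
     exists2 d, right_derivative f x d & 0 <= d} ->
  forall x y, a <= x -> x <= y -> f x <= f y.
Proof.
move=> fl a0 fae x y ax xy; rewrite -lerN2.
apply: (@locally_lipschitz_nonincreasing (fun z => - f z) a) => //.
  exact: locally_lipschitzN.
apply: ae_imply fae => z Hz /Hz[d fd d0]; exists (- d).
  exact: right_derivativeN.
by rewrite oppr_le0.
Qed.

(** Monotonicity applied to [- f] and to [f - M x]. It lets labels that are only assumed absolutely
    continuous be treated as Lipschitz. *)
Lemma ac_lipschitz f M : (forall b, 0 <= b -> absolutely_continuous f 0 b) ->
  {ae lebesgue_measure, forall x, 0 <= x ->
     exists2 d, right_derivative f x d & 0 <= d <= M} ->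
  forall x y, 0 <= x -> x <= y -> 0 <= f y - f x <= M * (y - x).
Proof.
move=> fac fae x y x0 xy; have y0 := le_trans x0 xy.
have rid z : right_derivative (id : R -> R) z 1 by exact: right_derivative_id.
apply/andP; split.
  have : -1 * f y + 0 * y <= -1 * f x + 0 * x.
    apply: (@ac_nonincreasing R (fun z => -1 * f z + 0 * z)) => //.
      exact: ac_affine (fac _ y0).
    apply: ae_imply fae => z Hz /andP[xz _].
    have [|d fd /andP[d0 dM]] := Hz; first exact: le_trans xz.
    exists (-1 * d + 0 * 1); last by lra.
    by apply: right_derivativeD; apply: right_derivativeZ.
  by lra.
have : 1 * f y + (- M) * y <= 1 * f x + (- M) * x.
  apply: (@ac_nonincreasing R (fun z => 1 * f z + (- M) * z)) => //.
    exact: ac_affine (fac _ y0).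
  apply: ae_imply fae => z Hz /andP[xz _].
  have [|d fd /andP[d0 dM]] := Hz; first exact: le_trans xz.
  exists (1 * d + (- M) * 1); last by lra.
  by apply: right_derivativeD; apply: right_derivativeZ.
by lra.
Qed.

End LocallyLipschitz.

(** * Thin flows *)

Section Flows.
Variables (R : realType) (V E : finType) (N : network R V E).
Implicit Types (e : E) (v w : V) (A B : {set E}) (x : xarc N -> R).

(** Summation by parts: the terms are regrouped by the head and by the tail of the arcs. *)
Lemma flow_divergence x (K : option V -> R) :
  \sum_a x a * (K (xtgt a) - K (xsrc a)) = - \sum_o K o * net_outflow x o.
Proof.
have P (f : xarc N -> option V) :
    \sum_o K o * (\sum_(a | f a == o) x a) = \sum_a x a * K (f a).
  rewrite [RHS](partition_big f xpredT)//=; apply: eq_bigr => o _.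
  by rewrite mulr_sumr; apply: eq_bigr => a /eqP ->; rewrite mulrC.
rewrite -sumrN.
under [RHS]eq_bigr do rewrite /net_outflow -mulrN opprB mulrBr.
by rewrite sumrB !P -sumrB; apply: eq_bigr => a _; rewrite mulrBr.
Qed.

Lemma flow_telescope x value (k : V -> R) : static_flow x value ->
  \sum_e x (inl e) * (k (tgt N e) - k (src N e))
  + \sum_(s : source N) x (inr s) * k (val s) = value * k (sink N).
Proof.
move=> [x0 xc xv].
have S (K : option V -> R) :
    \sum_a x a * (K (xtgt a) - K (xsrc a)) =
    - (K None * value + K (Some (sink N)) * net_outflow x (Some (sink N))).
  rewrite flow_divergence (bigD1 None)//= xv (bigD1 (Some (sink N)))//=.
  rewrite big1 ?addr0// => o /andP[oN oS]; by rewrite xc// mulr0.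
(* The constant potential shows that the sink absorbs exactly [value], which [static_flow] does not
   say explicitly. *)
have := S (fun=> 1); rewrite big1 => [|a _]; last by rewrite subrr mulr0.
rewrite !mul1r => Hv.
have := S (fun o => if o is Some v then k v else 0); rewrite mul0r add0r.
have -> : net_outflow x (Some (sink N)) = - value by lra.
rewrite mulrN opprK mulrC => <-.
rewrite big_sumType/=; congr (_ + _).
by apply: eq_bigr => s _; rewrite subr0.
Qed.

Lemma walk_invariant (Q : V -> Prop) A v p w :
  (forall e, e \in A -> Q (src N e) -> Q (tgt N e)) ->
  walk N A v p w -> Q v -> Q w.
Proof.
move=> QA; elim: p v => [|e p IH] v /=; first by move/eqP => ->.
by case/and3P => eA /eqP <- /IH H /(QA _ eA).
Qed.

Lemma walk_suffix A v p w e : walk N A v p w -> e \in p ->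
  exists q, walk N A (tgt N e) q w.
Proof.
elim: p v => [|f p IH] v //= /and3P[_ _ wf]; rewrite inE => /orP[/eqP ->|ep].
  by exists p.
exact: IH wf ep.
Qed.

(* The consequences of the thin flow equations for [E' = A] and [Estar = B] that
   are used once the labels [p] are known to be nonnegative. *)
Record regular_flow A B (p : V -> R) (x : E -> R) : Prop := {
  regular_balance : forall k : V -> R,
    \sum_e x e * (k (tgt N e) - k (src N e))
    + \sum_(s : source N) inflow N (val s) * p (val s) * k (val s)
    = total_inflow N * k (sink N);
  regular_ge0 : forall e, 0 <= x e;
  regular_label_ge0 : forall v, 0 <= p v;
  regular_capacity : forall e, x e <= capacity N e * p (tgt N e);
  regular_support : forall e, 0 < x e -> e \in A;
  regular_resetting : forall e, e \in B -> x e = capacity N e * p (tgt N e);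
  regular_increasing : forall e, e \in A -> p (src N e) < p (tgt N e) ->
    x e = capacity N e * p (tgt N e);
  regular_decreasing : forall e, e \notin B -> p (tgt N e) < p (src N e) ->
    x e = 0 }.

Hypothesis HN : network_axioms N.

Lemma inflow_pos (s : source N) : 0 < inflow N (val s).
Proof. exact: inflow_gt0 HN _ (valP s). Qed.

Lemma total_inflow_gt0 : 0 < total_inflow N.
Proof.
have [s sS _] := reachable_from_source HN (sink N).
rewrite /total_inflow (bigD1 s)//= ltr_pwDl// ?(inflow_gt0 HN)//.
by apply: sumr_ge0 => i /andP[iS _]; rewrite ltW// (inflow_gt0 HN).
Qed.

(** The source equations express the flow on the arcs of the super-source as [u_s p_s], which
    eliminates these arcs. *)
Lemma thin_flow_balance A B p x : thin_flow A B p x -> forall k : V -> R,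
    \sum_e x (inl e) * (k (tgt N e) - k (src N e))
    + \sum_(s : source N) inflow N (val s) * p (val s) * k (val s)
    = total_inflow N * k (sink N).
Proof.
move=> tf k; rewrite -(flow_telescope k (thin_flow_static tf)); congr (_ + _).
apply: eq_bigr => s _; rewrite (thin_flow_source tf).
by rewrite [inflow _ _ * _]mulrC divfK// gt_eqF// inflow_pos.
Qed.

Lemma thin_flow_source_ge0 A B p x : thin_flow A B p x ->
  forall s : source N, 0 <= p (val s).
Proof.
move=> tf s; rewrite (thin_flow_source tf); apply: divr_ge0.
  by case: (thin_flow_static tf).
exact/ltW/inflow_pos.
Qed.

(** Taking positive parts of the labels gives another solution, since source labels and the
    quotients [x_e / nu_e] are nonnegative anyway; maximality then applies. *)
Lemma maximal_label_ge0 A B p : maximal_label N A B p -> forall v, 0 <= p v.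
Proof.
move=> [[x tf] pmax] v.
suff /pmax /(_ v) : thin_flow A B (fun v => Num.max (p v) 0) x.
  by rewrite ge_max => /andP[].
have x0 a : 0 <= x a by case: (thin_flow_static tf).
have xc e : 0 <= x (inl e) / capacity N e.
  by rewrite divr_ge0// ltW// (capacity_gt0 HN).
have xcp e : 0 < x (inl e) -> 0 < x (inl e) / capacity N e.
  by move=> h; rewrite divr_gt0// (capacity_gt0 HN).
split.
- exact: thin_flow_static tf.
- exact: thin_flow_support tf.
- by move=> s; rewrite max_l ?(thin_flow_source tf)// -(thin_flow_source tf)
    (thin_flow_source_ge0 tf).
- move=> e /(thin_flow_le tf); rewrite /rho; case: ifP => _.
    by rewrite ge_max xc andbT.
  by rewrite ge_max [X in _ && X]le_max xc orbT andbT !le_max => /orP[->|->];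
    rewrite ?orbT.
- move=> e eA xe; rewrite (thin_flow_eq tf eA xe) /rho; case: ifP => _.
    by rewrite max_l// xc.
  rewrite [LHS]max_l; last by rewrite le_max xc orbT.
  by rewrite maxAC [RHS]max_l// le_max xc orbT.
Qed.

Lemma thin_flow_regular A B p x : thin_flow A B p x -> (forall v, 0 <= p v) ->
  B \subset A -> regular_flow A B p (fun e => x (inl e)).
Proof.
move=> tf p0 BA.
have x0 a : 0 <= x a by case: (thin_flow_static tf).
have nu0 e : 0 < capacity N e by exact: capacity_gt0 HN e.
have supp e : 0 < x (inl e) -> e \in A.
  by move=> xe; apply: contraTT xe => /(thin_flow_support tf) ->; rewrite ltxx.
have xle e : 0 < x (inl e) -> x (inl e) / capacity N e <= p (tgt N e).
  move=> xe; rewrite (thin_flow_eq tf (supp _ xe) xe) /rho; case: ifP => // _.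
  by rewrite le_max lexx orbT.
have cap e : x (inl e) <= capacity N e * p (tgt N e).
  rewrite mulrC -ler_pdivrMr//; have := x0 (inl e); rewrite le_eqVlt => /orP[|].
    by move/eqP => <-; rewrite mul0r.
  exact: xle.
have capE e : p (tgt N e) <= x (inl e) / capacity N e ->
    x (inl e) = capacity N e * p (tgt N e).
  by rewrite ler_pdivlMr// mulrC => h; apply/eqP; rewrite eq_le h cap.
split => //.
- exact: thin_flow_balance tf.
- move=> e eB.
  by apply: capE; have := thin_flow_le tf (fintype.subsetP BA _ eB); rewrite /rho eB.
- move=> e eA pe; apply: capE; have := thin_flow_le tf eA; rewrite /rho.
  by case: ifP => // _; rewrite le_max leNgt pe.
- move=> e eB pe; apply/eqP; have := x0 (inl e); rewrite le_eqVlt eq_sym.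
  case/orP => // xe; have := thin_flow_eq tf (supp _ xe) xe.
  rewrite /rho (negbTE eB) => pE; have : p (src N e) <= p (tgt N e).
    by rewrite pE le_max lexx.
  by rewrite leNgt pe.
Qed.

Section RegularFlow.
Variables (A B : {set E}) (p : V -> R) (x : E -> R).
Hypothesis rf : regular_flow A B p x.

Lemma regular_tgt_gt0 e : 0 < x e -> 0 < p (tgt N e).
Proof.
move=> xe; have := lt_le_trans xe (regular_capacity rf e).
by rewrite pmulr_rgt0// (capacity_gt0 HN).
Qed.

(** A node of label [0] receives no flow, by the capacity bound on entering arcs and the source
    equation; conservation, tested with the indicator of the node, then lets none leave. *)
Lemma regular_src_gt0 e : 0 < x e -> 0 < p (src N e).
Proof.
move=> xe; rewrite lt_neqAle (regular_label_ge0 rf) andbT; apply/negP => /eqP p0.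
have := regular_balance rf (fun v => (v == src N e)%:R).
have T0 f : tgt N f == src N e -> x f = 0.
  move=> /eqP te; apply/eqP; rewrite eq_le (regular_ge0 rf) andbT.
  by apply: le_trans (regular_capacity rf f) _; rewrite te -p0 mulr0.
have S0 : \sum_(s : source N)
    inflow N (val s) * p (val s) * (val s == src N e)%:R = 0.
  rewrite big1// => s _; case: eqP => [->|_]; last by rewrite mulr0.
  by rewrite -p0 mulr0 mul0r.
rewrite S0 addr0 (bigD1 e)//= eqxx.
have te : tgt N e == src N e = false.
  by apply/negP => /T0 x0; rewrite x0 ltxx in xe.
rewrite te sub0r mulrN1 => H.
have : \sum_(i | i != e) x i * ((tgt N i == src N e)%:R - (src N i == src N e)%:R) <= 0.
  apply: sumr_le0 => i _; case: (boolP (_ == _)) => [/T0 ->|_].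
    by rewrite mul0r.
  by rewrite sub0r mulrN oppr_le0 mulr_ge0 ?(regular_ge0 rf).
have : 0 <= total_inflow N * (sink N == src N e)%:R.
  by rewrite mulr_ge0// ltW// total_inflow_gt0.
by lra.
Qed.

(** With label [0] the sink would receive nothing, although the total inflow is positive. *)
Lemma regular_sink_gt0 : 0 < p (sink N).
Proof.
rewrite lt_neqAle (regular_label_ge0 rf) andbT; apply/negP => /eqP p0.
have := regular_balance rf (fun v => (v == sink N)%:R).
rewrite eqxx mulr1 => H; have := total_inflow_gt0; rewrite -H ltNge => /negP; apply.
rewrite -[leRHS]addr0; apply: lerD; apply: sumr_le0.
  move=> e _; case: eqP => [te|_]; last first.
    by rewrite sub0r mulrN oppr_le0 mulr_ge0 ?(regular_ge0 rf).
  have -> : x e = 0.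
    apply/eqP; rewrite eq_le (regular_ge0 rf) andbT.
    by apply: le_trans (regular_capacity rf e) _; rewrite te -p0 mulr0.
  by rewrite mul0r.
move=> s _; case: eqP => [->|_]; last by rewrite mulr0.
by rewrite -p0 mulr0 mul0r.
Qed.

End RegularFlow.

Lemma active_resettingS (l : V -> R) : resetting_arcs N l \subset active_arcs N l.
Proof. by apply/fintype.subsetP => e; rewrite !inE => /ltW. Qed.

(* Nodes of label [0] carry no flow, so the label [0] spreads along active arcs and
   would reach the sink. *)
Lemma resetting_label_gt0 (l p : V -> R) x : feasible N l ->
  thin_flow (active_arcs N l) (resetting_arcs N l) p x ->
  (forall v, 0 <= p v) ->
  forall e, e \in resetting_arcs N l -> 0 < p (tgt N e).
Proof.
move=> fl tf p0 e eB; rewrite lt_neqAle p0 andbT; apply/negP => /eqP pe.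
have rf := thin_flow_regular tf p0 (active_resettingS l).
have [s sS [q /andP[qw _] eq]] := feasible_resetting_path fl eB.
have [r rw] := walk_suffix qw eq.
have := regular_sink_gt0 rf; rewrite (_ : p (sink N) = 0) ?ltxx//.
apply: (walk_invariant (Q := fun v => p v = 0) _ rw) => // f fA pf.
have xf : x (inl f) = 0.
  apply/eqP; rewrite eq_le (regular_ge0 rf f) andbT leNgt.
  by apply/negP => /(regular_src_gt0 rf); rewrite pf ltxx.
apply/eqP; rewrite eq_le p0 andbT; have := thin_flow_le tf fA.
by rewrite /rho xf pf mul0r; case: ifP => //; rewrite maxxx.
Qed.

End Flows.

(** * The logarithmic inequality *)

Section Log.
Variable R : realType.
Implicit Types y n p : R.

Lemma ln_ltB1 y : 0 < y -> y != 1 -> ln y < y - 1.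
Proof.
move=> y0 y1; rewrite -ltr_expR lnK ?posrE//.
have := @expR_gt1Dx R (y - 1); rewrite addrCA subrr addr0; apply.
by rewrite subr_eq0.
Qed.

(** The defect in [ln z <= z - 1] at [z = 1 / y]; it vanishes only at [y = 1]. *)
Definition log_gap y : R := ln y - 1 + y^-1.

Lemma log_gap_ge0 y : 0 < y -> 0 <= log_gap y.
Proof.
by move=> y0; have := ln_leB1 (R := R) (x := y^-1); rewrite invr_gt0 lnV ?posrE// /log_gap => /(_ y0); lra.
Qed.

Lemma log_gap_eq0 y : 0 < y -> log_gap y = 0 -> y = 1.
Proof.
move=> y0 y1; apply: contrapT => /eqP yn1.
have : ln y^-1 < y^-1 - 1 by apply: ln_ltB1; rewrite ?invr_gt0// invr_eq1.
by rewrite lnV ?posrE//; move: y1; rewrite /log_gap; lra.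
Qed.

(** As a function of [p] this is concave, with tangent [p - n] at [p = n]. It serves as the node
    potential in the flow balance, so that its differences along arcs telescope. *)
Definition log_ratio n p : R := n * ln (p / n).

(** This splits the defect of an arc into two logarithmic gaps whose coefficients are nonnegative
    when [nv <= nw]. *)
Lemma log_arc_gapE nv nw pv pw : 0 < nv -> 0 < nw -> 0 < pv -> 0 < pw ->
  nw / pw * (nw - nv) + (log_ratio nw pw - log_ratio nv pv)
   - nw / pw * (pw - pv) =
  (nw - nv) * log_gap (pw / nw) + nv * log_gap (pw / nw * (pv / nv)^-1).
Proof.
move=> nv0 nw0 pv0 pw0; rewrite /log_ratio /log_gap.
have r0 : 0 < pw / nw by exact: divr_gt0.
have s0 : 0 < pv / nv by exact: divr_gt0.
have -> : ln (pw / nw * (pv / nv)^-1) = ln (pw / nw) - ln (pv / nv).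
  by rewrite ln_div ?posrE.
set a := ln (pw / nw); set b := ln (pv / nv).
by field; rewrite !gt_eqF.
Qed.

Lemma log_source_gapE n p : 0 < n -> 0 < p ->
  n ^+ 2 - n * p + p * log_ratio n p = n * p * log_gap (p / n).
Proof.
by move=> n0 p0; rewrite /log_ratio /log_gap; set a := ln _; field; rewrite !gt_eqF.
Qed.

Lemma log_source_gap_ge0 n p : 0 < n -> 0 <= p ->
  0 <= n ^+ 2 - n * p + p * log_ratio n p.
Proof.
move=> n0; rewrite le_eqVlt => /orP[/eqP <-|p0].
  by rewrite mulr0 mul0r addr0 subr0 sqr_ge0.
rewrite log_source_gapE// mulr_ge0 ?log_gap_ge0 ?divr_gt0//.
by rewrite mulr_ge0 ?ltW.
Qed.

Lemma log_source_gap_eq0 n p : 0 < n -> 0 <= p ->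
  n ^+ 2 - n * p + p * log_ratio n p = 0 -> p = n.
Proof.
move=> n0; rewrite le_eqVlt => /orP[/eqP <-|p0].
  by rewrite mulr0 mul0r addr0 subr0 => /eqP; rewrite sqrf_eq0 => /eqP.
rewrite log_source_gapE// => /eqP; rewrite !mulf_eq0 (gt_eqF n0) (gt_eqF p0)/= => /eqP.
move/(log_gap_eq0 (divr_gt0 p0 n0)) => pn.
by rewrite -[p](@divfK _ n) ?gt_eqF// pn mul1r.
Qed.

Lemma log_sink_gap_ge0 n p : 0 < n -> 0 < p -> 0 <= p - n - log_ratio n p.
Proof.
move=> n0 p0; have := ln_leB1 (divr_gt0 p0 n0).
rewrite -(ler_pM2l n0) mulrBr mulrCA divff ?gt_eqF// !mulr1 /log_ratio; lra.
Qed.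

End Log.

(** * Queue rates and the master inequality *)

Section Rates.
Variables (R : realType) (V E : finType) (N : network R V E).
Hypothesis HN : network_axioms N.
Implicit Types (e : E) (v w : V) (A B : {set E}) (l p n : V -> R).

(** The growth rate of the queueing delay: arcs of [B] have a queue, whereas an active arc outside
    [B] has delay exactly [0] and can only build one up. *)
Definition queue_rate A B p e : R :=
  if e \in B then p (tgt N e) - p (src N e)
  else if e \in A then Num.max (p (tgt N e) - p (src N e)) 0 else 0.

Section Gaps.
Variables (A B : {set E}) (p : V -> R) (x : E -> R).
Hypothesis rf : regular_flow N A B p x.
Hypothesis Bp : forall e, e \in B -> 0 < p (tgt N e).

(* If the label of the head is [0] then so is [x e], and the division gives [0]. *)
Lemma queue_rateE e : capacity N e * queue_rate A B p e =
  x e / p (tgt N e) * (p (tgt N e) - p (src N e)).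
Proof.
rewrite /queue_rate; case: ifPn => eB.
  by rewrite (regular_resetting rf eB) mulfK// gt_eqF// Bp.
have [eA|eA] := boolP (e \in A); last first.
  have -> : x e = 0.
    apply/eqP; rewrite eq_le (regular_ge0 rf) andbT leNgt.
    by apply: contra eA => /(regular_support rf).
  by rewrite mulr0 !mul0r.
case: (ltgtP (p (src N e)) (p (tgt N e))) => pe.
- have pw : 0 < p (tgt N e) by apply: le_lt_trans pe; exact: regular_label_ge0 rf _.
  rewrite max_l ?subr_ge0 ?ltW// (regular_increasing rf eA pe) mulfK//.
  by rewrite gt_eqF.
- by rewrite max_r ?subr_le0 ?ltW// (regular_decreasing rf eB pe) mulr0 !mul0r.
- by rewrite pe subrr maxxx !mulr0.
Qed.

Lemma rate_le_capacity e : x e / p (tgt N e) <= capacity N e.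
Proof.
have := regular_label_ge0 rf (tgt N e); rewrite le_eqVlt => /orP[/eqP <-|pw].
  by rewrite invr0 mulr0 ltW// (capacity_gt0 HN).
by rewrite ler_pdivrMr// (regular_capacity rf).
Qed.

Lemma rate_ge0 e : 0 <= x e / p (tgt N e).
Proof. by rewrite divr_ge0 ?(regular_ge0 rf) ?(regular_label_ge0 rf). Qed.

Variable n : V -> R.
Hypothesis n0 : forall v, 0 < n v.
(** In both applications flow uses active arcs only. For average labels these are increasing because
    transit times are nonnegative; for [lam] this is known only from some time on. *)
Hypothesis n_mono : forall e, 0 < x e -> n (src N e) <= n (tgt N e).

(* With [D = p - n] and [h = n ln (p / n)], the gap of an arc is [x e] times the
   defect in [n_w / p_w * (D_w - D_v) <= h_w - h_v]. *)
Definition arc_gap e : R :=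
  let v := src N e in let w := tgt N e in
  x e / p w * n w * (n w - n v) + x e * (log_ratio (n w) (p w) - log_ratio (n v) (p v))
  - x e / p w * n w * (p w - p v).

Definition source_gap (s : source N) : R := inflow N (val s) *
  (n (val s) ^+ 2 - n (val s) * p (val s) + p (val s) * log_ratio (n (val s)) (p (val s))).

Definition sink_gap : R := total_inflow N *
  (p (sink N) - n (sink N) - log_ratio (n (sink N)) (p (sink N))).

Lemma arc_gap_pos e : 0 < x e ->
  arc_gap e = x e * ((n (tgt N e) - n (src N e)) * log_gap (p (tgt N e) / n (tgt N e))
    + n (src N e) * log_gap (p (tgt N e) / n (tgt N e) * (p (src N e) / n (src N e))^-1)).
Proof.
move=> xe; rewrite -log_arc_gapE//; last 2 first.
- exact: regular_src_gt0 rf _ xe.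
- exact: regular_tgt_gt0 rf _ xe.
rewrite /arc_gap; ring.
Qed.

Lemma arc_gap_ge0 e : 0 <= arc_gap e.
Proof.
have := regular_ge0 rf e; rewrite le_eqVlt => /orP[/eqP xe|xe].
  by rewrite /arc_gap -xe !mul0r addr0 subr0.
have pv := regular_src_gt0 HN rf xe.
have pw := regular_tgt_gt0 HN rf xe.
rewrite arc_gap_pos// mulr_ge0 ?(ltW xe)// addr_ge0// mulr_ge0 ?log_gap_ge0 //.
- by rewrite subr_ge0 n_mono.
- by rewrite divr_gt0.
- exact/ltW.
- by rewrite mulr_gt0 ?invr_gt0 ?divr_gt0.
Qed.

Lemma arc_gap_eq0 e : 0 < x e -> arc_gap e = 0 ->
  p (tgt N e) / n (tgt N e) = p (src N e) / n (src N e) /\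
  (n (src N e) < n (tgt N e) -> p (tgt N e) = n (tgt N e)).
Proof.
move=> xe; have pv := regular_src_gt0 HN rf xe.
have pw := regular_tgt_gt0 HN rf xe.
have r0 : 0 < p (tgt N e) / n (tgt N e) by rewrite divr_gt0.
have s0 : 0 < p (src N e) / n (src N e) by rewrite divr_gt0.
have q0 : 0 < p (tgt N e) / n (tgt N e) * (p (src N e) / n (src N e))^-1.
  by rewrite mulr_gt0// invr_gt0.
rewrite arc_gap_pos// => /eqP; rewrite mulf_eq0 gt_eqF//=.
rewrite paddr_eq0 ?mulr_ge0 ?log_gap_ge0// ?subr_ge0 ?n_mono// ?ltW//.
rewrite !mulf_eq0 subr_eq0 (gt_eqF (n0 (src N e)))/= => /andP[H /eqP].
move=> /(log_gap_eq0 q0) q1; split.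
  by rewrite -[LHS](divfK (lt0r_neq0 s0)) q1 mul1r.
move=> nlt; move: H; rewrite gt_eqF//= => /eqP /(log_gap_eq0 r0) r1.
by rewrite -[LHS](divfK (lt0r_neq0 (n0 (tgt N e)))) r1 mul1r.
Qed.

Lemma source_gap_ge0 s : 0 <= source_gap s.
Proof.
apply: mulr_ge0; first exact/ltW/inflow_pos.
by apply: log_source_gap_ge0 => //; exact: regular_label_ge0 rf _.
Qed.

Lemma sink_gap_ge0 : 0 <= sink_gap.
Proof.
apply: mulr_ge0; first exact/ltW/total_inflow_gt0.
by apply: log_sink_gap_ge0 => //; exact: (regular_sink_gt0 HN rf).
Qed.

(** The logarithmic terms of arcs, sources and sink cancel by flow balance tested with
    [log_ratio]. *)
Lemma gap_sum :
  (\sum_e x e / p (tgt N e) * n (tgt N e) * (n (tgt N e) - n (src N e))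
   + \sum_(s : source N) inflow N (val s) * n (val s) ^+ 2
   - total_inflow N * n (sink N))
  - (\sum_e capacity N e * n (tgt N e) * queue_rate A B p e
     + \sum_(s : source N) inflow N (val s) * n (val s) * p (val s)
     - total_inflow N * p (sink N))
  = \sum_e arc_gap e + \sum_s source_gap s + sink_gap.
Proof.
have bal := regular_balance rf (fun v => log_ratio (n v) (p v)).
have -> : \sum_e capacity N e * n (tgt N e) * queue_rate A B p e =
    \sum_e x e / p (tgt N e) * n (tgt N e) * (p (tgt N e) - p (src N e)).
  apply: eq_bigr => e _; rewrite mulrAC queue_rateE; ring.
have -> : \sum_e arc_gap e =
  \sum_e x e / p (tgt N e) * n (tgt N e) * (n (tgt N e) - n (src N e)) +
  \sum_e x e * (log_ratio (n (tgt N e)) (p (tgt N e)) - log_ratio (n (src N e)) (p (src N e)))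
  - \sum_e x e / p (tgt N e) * n (tgt N e) * (p (tgt N e) - p (src N e)).
  by rewrite -big_split -sumrB.
have -> : \sum_s source_gap s =
  \sum_(s : source N) inflow N (val s) * n (val s) ^+ 2
  - \sum_(s : source N) inflow N (val s) * n (val s) * p (val s)
  + \sum_(s : source N) inflow N (val s) * p (val s) * log_ratio (n (val s)) (p (val s)).
  by rewrite -sumrB -big_split; apply: eq_bigr => s _; rewrite /source_gap /=; ring.
rewrite /sink_gap; lra.
Qed.

Lemma master_inequality :
  \sum_e capacity N e * n (tgt N e) * queue_rate A B p e
  + \sum_(s : source N) inflow N (val s) * n (val s) * p (val s)
  - total_inflow N * p (sink N) <=
  \sum_e x e / p (tgt N e) * n (tgt N e) * (n (tgt N e) - n (src N e))
  + \sum_(s : source N) inflow N (val s) * n (val s) ^+ 2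
  - total_inflow N * n (sink N).
Proof.
rewrite -subr_ge0 gap_sum; apply: addr_ge0; last exact: sink_gap_ge0.
by apply: addr_ge0; apply: sumr_ge0 => i _; [exact: arc_gap_ge0|exact: source_gap_ge0].
Qed.

End Gaps.
End Rates.

(** * The steady-state direction *)

Section FiniteBounds.
Variable R : realType.

Lemma finite_lower_bound (I : finType) (Q : I -> R -> Prop) :
  (forall i c d, d <= c -> Q i c -> Q i d) ->
  (forall i, exists2 c, 0 < c & Q i c) ->
  exists2 c, 0 < c & forall i, Q i c.
Proof.
move=> Qle Qex.
suff [c c0 Hc] : exists2 c, 0 < c & forall i, i \in enum I -> Q i c.
  by exists c => // i; apply: Hc; rewrite mem_enum.
elim: (enum I) => [|i s [c c0 Hc]]; first by exists 1.
have [d d0 Hd] := Qex i.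
exists (Num.min c d); first by rewrite lt_min c0.
move=> j; rewrite inE => /orP[/eqP ->|js].
  by apply: Qle Hd; rewrite ge_min lexx orbT.
by apply: Qle (Hc _ js); rewrite ge_min lexx.
Qed.

Lemma finite_positive_min (I : finType) (P : pred I) (F : I -> R) :
  (forall i, P i -> 0 < F i) ->
  exists2 c, 0 < c & forall i, P i -> c <= F i.
Proof.
move=> PF; apply: (finite_lower_bound (Q := fun i c => P i -> c <= F i)).
  by move=> i c d dc H /H; exact: le_trans.
move=> i; have [Pi|_] := boolP (P i); last by exists 1.
by exists (F i) => //; exact: PF.
Qed.

Lemma sum_le0_eq0 (I : finType) (F : I -> R) : (forall i, F i <= 0) ->
  0 <= \sum_i F i -> forall i, F i = 0.
Proof.
move=> F0 s0 i; have : \sum_i - F i == 0.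
  by rewrite sumrN oppr_eq0 eq_le s0 sumr_le0.
rewrite psumr_eq0 => [|j _]; last by rewrite oppr_ge0.
by move/allP/(_ i); rewrite mem_index_enum oppr_eq0 => /(_ isT)/eqP.
Qed.

End FiniteBounds.

Section Steady.
Variables (R : realType) (V E : finType) (N : network R V E).
Hypothesis HN : network_axioms N.
Variable lam : V -> R.
Hypothesis Hlam : steady_state_direction N lam.
Implicit Types (e : E) (v w : V) (A B : {set E}) (l p n : V -> R) (Z : {set V}).

Definition indicator Z v : R := (v \in Z)%:R.

Lemma steady_flow : exists2 x, thin_flow (N := N) [set: E]%SET finset.set0 lam x &
  regular_flow N [set: E]%SET finset.set0 lam (fun e => x (inl e)).
Proof.
have [[x tf] _] := Hlam; exists x => //.
have lam0 := maximal_label_ge0 HN Hlam.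
by apply: (thin_flow_regular HN tf lam0); rewrite finset.sub0set.
Qed.

(** The label [0] would spread to the sink: an arc from label [0] to a positive label would be
    saturated, but a node of label [0] emits no flow. *)
Lemma steady_gt0 v : 0 < lam v.
Proof.
have [x _ rf] := steady_flow.
rewrite lt_neqAle (regular_label_ge0 rf) andbT; apply/negP => /eqP v0.
have [q /andP[qw _]] := reaches_sink HN v.
have := regular_sink_gt0 HN rf; rewrite (_ : lam (sink N) = 0) ?ltxx//.
apply: (walk_invariant (Q := fun v => lam v = 0) _ qw) => // e _ e0.
apply/eqP; rewrite eq_le (regular_label_ge0 rf) andbT leNgt; apply/negP => w0.
have xe : x (inl e) = capacity N e * lam (tgt N e).
  by apply: (regular_increasing rf); rewrite ?inE ?e0.
have : 0 < x (inl e) by rewrite xe mulr_gt0// (capacity_gt0 HN).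
by move/(regular_src_gt0 HN rf); rewrite e0 ltxx.
Qed.

(** The balance equation tested with [lam] itself: arcs going up are saturated and arcs going down
    are empty. In other words, [cut_functional lam lam = 0]. *)
Lemma steady_identity :
  \sum_e capacity N e * lam (tgt N e) * Num.max (lam (tgt N e) - lam (src N e)) 0
  + \sum_(s : source N) inflow N (val s) * lam (val s) ^+ 2
  = total_inflow N * lam (sink N).
Proof.
have [x _ rf] := steady_flow; rewrite -(regular_balance rf lam).
congr (_ + _); last by apply: eq_bigr => s _; rewrite expr2 mulrA.
apply: eq_bigr => e _; case: (ltgtP (lam (src N e)) (lam (tgt N e))) => le.
- by rewrite max_l ?subr_ge0 ?ltW// (regular_increasing rf)// inE.
- rewrite (regular_decreasing rf)//; last by rewrite inE.
  by rewrite max_r ?subr_le0 ?ltW// mulr0 mul0r.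
- by rewrite le subrr maxxx !mulr0.
Qed.

(* Otherwise adding a small constant to [lam] on [Z] gives a larger solution. *)
Lemma steady_entering_arc Z : (exists v, v \in Z) ->
  (forall s, s \in sources N -> s \notin Z) ->
  exists e, [/\ src N e \notin Z, tgt N e \in Z & lam (src N e) <= lam (tgt N e)].
Proof.
move=> [v0 v0Z] SZ; apply: contrapT => noarc.
have down e : src N e \notin Z -> tgt N e \in Z -> lam (tgt N e) < lam (src N e).
  by move=> h1 h2; rewrite ltNge; apply/negP => h3; apply: noarc; exists e.
have [x tf rf] := steady_flow.
have xdown e : src N e \notin Z -> tgt N e \in Z -> x (inl e) = 0.
  by move=> h1 h2; rewrite (regular_decreasing rf) ?inE ?down.
have srcZ (k : V -> R) : \sum_(s : source N)
    inflow N (val s) * lam (val s) * (k (val s) * indicator Z (val s)) = 0.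
  apply: big1 => s _; rewrite /indicator (negbTE (SZ _ (valP s))) !mulr0//.
have x0 e : 0 <= x (inl e) by exact: regular_ge0 rf e.
(* No flow enters [Z] along arcs or from sources, so conservation on [Z] lets none leave. *)
have xup e : src N e \in Z -> tgt N e \notin Z -> x (inl e) = 0.
  move=> eZ wZ; have := regular_balance rf (fun v => 1 * indicator Z v).
  rewrite (srcZ (fun=> 1)) addr0 => bal.
  have := @sum_le0_eq0 R _ (fun e => x (inl e) *
    (1 * indicator Z (tgt N e) - 1 * indicator Z (src N e))) _ _ e.
  rewrite bal /indicator eZ (negbTE wZ) mulr0 mulr1 sub0r mulrN1.
  move=> H; apply/eqP; rewrite -oppr_eq0; apply/eqP; apply: H.
    move=> f; have := xdown f; have := x0 f.
    case: (src N f \in Z); case: (tgt N f \in Z) => xf //=.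
    + by rewrite subrr mulr0.
    + by rewrite mulr0 sub0r !mulr1 mulrN1 oppr_le0.
    + by move=> ->//; rewrite mul0r.
    + by rewrite subrr mulr0.
  by apply: mulr_ge0; [exact/ltW/total_inflow_gt0|rewrite mul1r ler0n].
have tZ : sink N \notin Z.
  apply/negP => tZ; have := regular_balance rf (fun v => 1 * indicator Z v).
  rewrite (srcZ (fun=> 1)) addr0 big1 => [|e _].
    rewrite /indicator tZ !mulr1 => /eqP; rewrite eq_sym gt_eqF// total_inflow_gt0//.
  rewrite /indicator; have := xdown e; have := xup e.
  case: (src N e \in Z); case: (tgt N e \in Z) => //=.
  - by rewrite subrr mulr0.
  - by move=> ->//; rewrite mul0r.
  - by move=> _ ->//; rewrite mul0r.
  - by rewrite subrr mulr0.
(* The flow inside [Z] is a circulation, so its total gain in [lam] is zero; since flow never goes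
   down, no arc inside can go up, as it would be saturated. *)
have inside e : src N e \in Z -> tgt N e \in Z -> lam (tgt N e) <= lam (src N e).
  move=> eZ wZ; rewrite leNgt; apply/negP => le.
  have xe : x (inl e) = capacity N e * lam (tgt N e).
    by apply: (regular_increasing rf) => //; rewrite inE.
  have xpos : 0 < x (inl e) by rewrite xe mulr_gt0 ?steady_gt0// (capacity_gt0 HN).
  have := regular_balance rf (fun v => lam v * indicator Z v).
  have -> : indicator Z (sink N) = 0 by rewrite /indicator (negbTE tZ).
  rewrite (srcZ lam) addr0 !mulr0.
  move/eqP; rewrite psumr_eq0 => [/allP/(_ e)|f _].
    rewrite mem_index_enum /indicator eZ wZ !mulr1 => /(_ isT).
    by rewrite mulf_eq0 gt_eqF//= subr_eq0 gt_eqF.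
  rewrite /indicator; have := xdown f; have := xup f.
  case: (boolP (src N f \in Z)) => fv; case: (boolP (tgt N f \in Z)) => fw //=.
  - move=> _ _; rewrite !mulr1; case: (leP (lam (src N f)) (lam (tgt N f))) => h.
      by rewrite mulr_ge0// subr_ge0.
    by rewrite (regular_decreasing rf) ?inE// mul0r.
  - by move=> ->//; rewrite mul0r.
  - by move=> _ ->//; rewrite mul0r.
  - by rewrite !mulr0 subrr mulr0.
(* [del] is at most the drop of [lam] on each arc entering [Z], so raising [Z] by [del] keeps the
   inequalities there. *)
have [del del0 Hdel] := @finite_positive_min R E
  (fun e => (src N e \notin Z) && (tgt N e \in Z))
  (fun e => lam (src N e) - lam (tgt N e))
  (fun e h => ltac:(by case/andP: h => h1 h2; rewrite subr_gt0; exact: down)).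
pose k v := lam v + del * indicator Z v.
suff tk : thin_flow (N := N) [set: E]%SET finset.set0 k x.
  have [_ /(_ _ _ tk v0)] := Hlam.
  by rewrite /k /indicator v0Z mulr1 leNgt ltrDl del0.
have rhoE e a b : rho N finset.set0 e a b = Num.max a (b / capacity N e).
  by rewrite /rho inE.
split.
- exact: thin_flow_static tf.
- exact: thin_flow_support tf.
- move=> s; rewrite /k /indicator (negbTE (SZ _ (valP s))) mulr0 addr0.
  exact: thin_flow_source tf s.
- move=> e _; have := thin_flow_le tf (e := e); rewrite !rhoE inE => /(_ isT) le.
  rewrite /k /indicator.
  case: (boolP (tgt N e \in Z)) => wZ; case: (boolP (src N e \in Z)) => vZ.
  + by rewrite le_max lerD2r inside.
  + have := Hdel e; rewrite vZ wZ => /(_ isT) h.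
    by rewrite mulr1 mulr0 addr0 le_max; apply/orP; left; lra.
  + rewrite mulr0 addr0 (le_trans le)// mulr1 ge_max !le_max lexx orbT andbT.
    by rewrite lerDl (ltW del0).
  + by rewrite mulr0 !addr0.
- move=> e _ xe; have := thin_flow_eq tf (e := e); rewrite !rhoE inE => /(_ isT xe) le.
  rewrite /k /indicator.
  case: (boolP (tgt N e \in Z)) => wZ; case: (boolP (src N e \in Z)) => vZ.
  (* A flow-carrying arc inside [Z] joins equal labels, so raising both ends preserves the
     equation. *)
  + have lew : lam (src N e) <= lam (tgt N e) by rewrite le le_max lexx.
    have lE : lam (src N e) = lam (tgt N e) by apply/eqP; rewrite eq_le lew inside.
    rewrite !mulr1 max_l ?lE//.
    by rewrite (@le_trans _ _ (lam (tgt N e))) ?lerDl ?(ltW del0)// [leRHS]le le_max lexx orbT.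
  + by move: xe; rewrite xdown ?ltxx.
  + by move: xe; rewrite xup ?ltxx.
  + by rewrite !mulr0 !addr0.
Qed.

End Steady.

(** * The cut functional and uniqueness of the steady-state direction *)

Section CutFunctional.
Variables (R : realType) (V E : finType) (N : network R V E).
Implicit Types (e : E) (v w : V) (n c k : V -> R) (Z : {set V}).

(** For the indicator [c] of a set this is the capacity entering the set, with arc capacities
    [nu_e n_w] and source capacities [u_s n_s], minus the demand [u_0] if the set contains the sink.
    It is affine in [n] and convex in [c]. *)
Definition cut_functional n c : R :=
  \sum_e capacity N e * n (tgt N e) * Num.max (c (tgt N e) - c (src N e)) 0
  + \sum_(s : source N) inflow N (val s) * n (val s) * c (val s)
  - total_inflow N * c (sink N).

(** The directional derivative of [cut_functional n] at the point [n] in direction [c]. *)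
Definition cut_slope n c : R :=
  \sum_e capacity N e * n (tgt N e)
    * pos_right_derivative (n (tgt N e) - n (src N e)) (c (tgt N e) - c (src N e))
  + \sum_(s : source N) inflow N (val s) * n (val s) * c (val s)
  - total_inflow N * c (sink N).

(** The positive part is piecewise linear, so the first-order expansion is exact as long as the step
    does not cross the kink. *)
Lemma maxD_pos_right_derivative (a d del : R) : 0 < del -> `|d| <= 1 -> (a != 0 -> del <= `|a|) ->
  Num.max (a + del * d) 0 = Num.max a 0 + del * pos_right_derivative a d.
Proof.
move=> del0; rewrite ler_norml => /andP[d1 d2] Ha; rewrite /pos_right_derivative.
have h1 : del * d <= del by rewrite ler_piMr// ltW.
have h2 : - del <= del * d by rewrite -{1}[del]mulr1 -mulrN ler_pM2l.
case: ltgtP Ha => [a0|a0|a0] Ha.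
- move: (Ha isT); rewrite gtr0_norm// => ?; rewrite !max_l//; lra.
- move: (Ha isT); rewrite ltr0_norm// => ?; rewrite !max_r ?mulr0 ?addr0//; lra.
- by rewrite -a0 !add0r maxr_pMr ?mulr0// ltW.
Qed.

(* [n] minimises the convex function [cut_functional n], so its directional
   derivatives at [n] are nonnegative. *)
Lemma cut_slope_ge0 n c : (forall k, 0 <= cut_functional n k) ->
  cut_functional n n <= 0 -> (forall v w, `|c w - c v| <= 1) ->
  0 <= cut_slope n c.
Proof.
move=> g0 gn c1.
have [del del0 Hdel] := @finite_positive_min R E
  (fun e => n (tgt N e) - n (src N e) != 0)
  (fun e => `|n (tgt N e) - n (src N e)|) (fun e h => ltac:(by rewrite normr_gt0)).
have gE : cut_functional n (fun v => n v + del * c v) =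
    cut_functional n n + del * cut_slope n c.
  rewrite /cut_functional /cut_slope.
  have -> : \sum_e capacity N e * n (tgt N e) * Num.max
      (n (tgt N e) + del * c (tgt N e) - (n (src N e) + del * c (src N e))) 0 =
    \sum_e capacity N e * n (tgt N e) * Num.max (n (tgt N e) - n (src N e)) 0
    + del * \sum_e capacity N e * n (tgt N e)
       * pos_right_derivative (n (tgt N e) - n (src N e)) (c (tgt N e) - c (src N e)).
    rewrite mulr_sumr -big_split; apply: eq_bigr => e _ /=.
    rewrite (_ : n (tgt N e) + del * c (tgt N e) - (n (src N e) + del * c (src N e)) =
      n (tgt N e) - n (src N e) + del * (c (tgt N e) - c (src N e))); last by ring.
    by rewrite maxD_pos_right_derivative//; [ring|exact: Hdel].
  have -> : \sum_(s : source N) inflow N (val s) * n (val s) * (n (val s) + del * c (val s)) =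
    \sum_(s : source N) inflow N (val s) * n (val s) * n (val s)
    + del * \sum_(s : source N) inflow N (val s) * n (val s) * c (val s).
    by rewrite mulr_sumr -big_split; apply: eq_bigr => s _ /=; ring.
  by ring.
have := g0 (fun v => n v + del * c v); rewrite gE => h.
by rewrite -(pmulr_rge0 _ del0); lra.
Qed.

Hypothesis HN : network_axioms N.
Variable lam : V -> R.
Hypothesis Hlam : steady_state_direction N lam.

Lemma indicator_diff Z v w : `|indicator R Z w - indicator R Z v| <= 1.
Proof.
by rewrite /indicator; do 2!case: (_ \in Z);
  rewrite ?subrr ?subr0 ?sub0r ?normrN ?normr0 ?normr1 ?ler01.
Qed.

(** Slopes at the minimiser [n] are compared with the flow of [lam] in the directions given by the
    sets where [n] exceeds [lam] or falls below it. An arc entering such a set makes the slope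
    negative. *)
Lemma steady_unique n :
  (forall k, 0 <= cut_functional n k) -> cut_functional n n <= 0 ->
  (forall Z, (exists v, v \in Z) -> (forall s, s \in sources N -> s \notin Z) ->
    exists e, [/\ src N e \notin Z, tgt N e \in Z & n (src N e) <= n (tgt N e)]) ->
  forall v, n v = lam v.
Proof.
move=> g0 gn reach.
have [x _ rf] := steady_flow HN Hlam.
have nu0 e : 0 < capacity N e by exact: (capacity_gt0 HN).
have xge0 e : 0 <= x (inl e) by exact: (regular_ge0 rf e).
have xcap e : x (inl e) <= capacity N e * lam (tgt N e) by exact: (regular_capacity rf e).
have xup e : lam (src N e) < lam (tgt N e) -> x (inl e) = capacity N e * lam (tgt N e).
  by apply: (regular_increasing rf); rewrite inE.
have xdown e : lam (tgt N e) < lam (src N e) -> x (inl e) = 0.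
  by apply: (regular_decreasing rf); rewrite inE.
(* [T] and [U] are the shares of arcs and sources in the slope after subtracting the balance of the
   flow of [lam]. Their sum is nonnegative, so they vanish if none is positive. *)
pose T (c : V -> R) e := capacity N e * n (tgt N e)
    * pos_right_derivative (n (tgt N e) - n (src N e)) (c (tgt N e) - c (src N e))
    - x (inl e) * (c (tgt N e) - c (src N e)).
pose U (c : V -> R) (s : source N) := inflow N (val s) * (n (val s) - lam (val s)) * c (val s).
have TU (c : V -> R) : (forall v w, `|c w - c v| <= 1) ->
    (forall e, T c e <= 0) -> (forall s, U c s <= 0) ->
    (forall e, T c e = 0) /\ (forall s, U c s = 0).
  move=> c1 T0 U0; have := cut_slope_ge0 g0 gn c1.
  have -> : cut_slope n c = \sum_e T c e + \sum_s U c s.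
    rewrite /cut_slope -(regular_balance rf c) /T /U sumrB.
    have -> : \sum_(s : source N) inflow N (val s) * (n (val s) - lam (val s)) * c (val s) =
      \sum_(s : source N) inflow N (val s) * n (val s) * c (val s)
      - \sum_(s : source N) inflow N (val s) * lam (val s) * c (val s).
      by rewrite -sumrB; apply: eq_bigr => s _; ring.
    by ring.
  move=> h; have sT : \sum_e T c e <= 0 by exact: sumr_le0.
  have sU : \sum_s U c s <= 0 by exact: sumr_le0.
  by split; apply: sum_le0_eq0 => //; lra.
have cN Z v w : `|- indicator R Z w - - indicator R Z v| <= 1.
  by rewrite -opprD normrN indicator_diff.
have posN1 (a : R) : pos_right_derivative a (-1) = - (0 < a)%R%:R.
  by rewrite /pos_right_derivative; case: ltgtP => // _; rewrite ?oppr0// max_r// lerN10.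
have pos1 (a : R) : pos_right_derivative a 1 = (0 <= a)%R%:R.
  by rewrite /pos_right_derivative; case: ltgtP => // _; rewrite max_l// ler01.
have pos0 (a : R) : pos_right_derivative a 0 = 0 by rewrite /pos_right_derivative maxxx !if_same.
have nle v : n v <= lam v.
  rewrite leNgt; apply/negP => vlt.
  pose Z := [set v | lam v < n v]%SET.
  pose c v := - indicator R Z v.
  have Tle e : T c e <= 0.
    have cE : c (tgt N e) - c (src N e) = indicator R Z (src N e) - indicator R Z (tgt N e).
      by rewrite /c; ring.
    rewrite /T cE /indicator !inE.
    case: (ltP (lam (src N e)) (n (src N e))) => hv;
      case: (ltP (lam (tgt N e)) (n (tgt N e))) => hw.
    - by rewrite subrr pos0 !mulr0 subr0.
    - rewrite subr0 pos1 mulr1; case: (leP 0 (n (tgt N e) - n (src N e))) => h.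
        by rewrite mulr1 xup ?subr_le0 ?ler_pM2l//; lra.
      by rewrite mulr0 sub0r oppr_le0.
    - rewrite sub0r posN1 !mulrN1 opprK.
      case: (ltP 0 (n (tgt N e) - n (src N e))) => h.
        rewrite mulrN1 addrC subr_le0; apply: le_trans (xcap _) _.
        by rewrite ler_pM2l// ltW.
      by rewrite oppr0 mulr0 add0r xdown//; lra.
    - by rewrite subrr pos0 !mulr0 subr0.
  have Ule s : U c s <= 0.
    rewrite /U /c /indicator inE; case: ltP => h; last by rewrite oppr0 mulr0.
    by rewrite mulrN1 oppr_le0 mulr_ge0 ?(ltW (inflow_pos HN s))// subr_ge0 ltW.
  have [T0 U0] := TU _ (cN Z) Tle Ule.
  (* On this arc [n] strictly increases, so [T c e] is [x_e - nu_e n_w], which is negative because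
     [x_e <= nu_e lam_w < nu_e n_w]. *)
  have [||e [eZ wZ le]] := steady_entering_arc HN Hlam (Z := Z).
  - by exists v; rewrite inE.
  - move=> s sS; rewrite inE -leNgt leNgt; apply/negP => h.
    have /eqP := U0 (exist _ s sS); rewrite /U /c /indicator inE /= h mulrN1 oppr_eq0.
    by rewrite mulf_eq0 subr_eq0 !gt_eqF// (inflow_gt0 HN).
  have := T0 e; rewrite /T /c /indicator (negbTE eZ) wZ oppr0 subr0 posN1.
  move: eZ wZ; rewrite !inE -leNgt => eZ wZ.
  have -> : 0 < n (tgt N e) - n (src N e) by lra.
  rewrite !mulrN1 opprK.
  have : capacity N e * lam (tgt N e) < capacity N e * n (tgt N e) by rewrite ltr_pM2l.
  by have := xcap e; lra.
move=> v; apply/eqP; rewrite eq_le nle leNgt; apply/negP => vlt.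
pose Z := [set v | n v < lam v]%SET.
pose c v := indicator R Z v.
have nE u : u \notin Z -> n u = lam u.
  by rewrite inE -leNgt => h; apply/eqP; rewrite eq_le nle.
have Tle e : T c e <= 0.
  rewrite /T /c /indicator.
  case: (boolP (src N e \in Z)) => hv; case: (boolP (tgt N e \in Z)) => hw.
  - by rewrite subrr pos0 !mulr0 subr0.
  - rewrite sub0r posN1 !mulrN1 opprK; move: hv; rewrite inE => hv.
    have := nE _ hw => nw.
    case: (ltP 0 (n (tgt N e) - n (src N e))) => h.
      by rewrite mulrN1 addrC subr_le0 nw xcap.
    by rewrite oppr0 mulr0 add0r xdown//; lra.
  - rewrite subr0 pos1 mulr1; move: hw; rewrite inE => hw.
    have := nE _ hv => nv.
    case: (leP 0 (n (tgt N e) - n (src N e))) => h.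
      by rewrite mulr1 xup ?subr_le0 ?ler_pM2l ?(ltW hw)//; lra.
    by rewrite mulr0 sub0r oppr_le0.
  - by rewrite subrr pos0 !mulr0 subr0.
have Ule s : U c s <= 0.
  rewrite /U /c /indicator inE; case: ltP => h; last by rewrite mulr0.
  by rewrite mulr1 mulr_ge0_le0 ?(ltW (inflow_pos HN s))// subr_le0 ltW.
have [T0 U0] := TU _ (fun v w => indicator_diff Z v w) Tle Ule.
(* Outside [Z] the vectors agree, so [lam] strictly increases along this arc and saturates it; hence
   [T c e = nu_e (n_w - lam_w) < 0]. *)
have [||e [eZ wZ le]] := reach Z.
- by exists v; rewrite inE.
- move=> s sS; rewrite inE; apply/negP => h.
  have /eqP := U0 (exist _ s sS); rewrite /U /c /indicator inE /= h mulr1.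
  by rewrite mulf_eq0 subr_eq0 (lt_eqF h) orbF gt_eqF// (inflow_gt0 HN).
have := T0 e; rewrite /T /c /indicator (negbTE eZ) wZ subr0 pos1.
have nv := nE _ eZ; move: wZ; rewrite inE => wZ.
rewrite subr_ge0 le !mulr1 xup; last by lra.
have : capacity N e * n (tgt N e) < capacity N e * lam (tgt N e) by rewrite ltr_pM2l.
by lra.
Qed.

End CutFunctional.

(** * The potential *)

Section Potential.
Variables (R : realType) (V E : finType) (N : network R V E).
Hypothesis HN : network_axioms N.
Variable lam : V -> R.
Hypothesis Hlam : steady_state_direction N lam.
Implicit Types (e : E) (v w : V) (A B : {set E}) (l p k : V -> R) (Z : {set V}).

(** The dual objective, at node prices [l], of the minimum cost flow problem with costs [tau_e], arc
    capacities [nu_e lam_w] and supplies [u_s lam_s]. *)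
Definition potential l : R := total_inflow N * l (sink N)
  - \sum_(s : source N) inflow N (val s) * lam (val s) * l (val s)
  - \sum_e capacity N e * lam (tgt N e)
      * Num.max (l (tgt N e) - l (src N e) - transit N e) 0.

(* Right derivative of [potential] along a trajectory of direction [p]. *)
Definition potential_rate A B p : R := total_inflow N * p (sink N)
  - \sum_(s : source N) inflow N (val s) * lam (val s) * p (val s)
  - \sum_e capacity N e * lam (tgt N e) * queue_rate N A B p e.

Lemma potential_flow A B x k : regular_flow N A B lam x ->
  potential k = \sum_e (x e * (k (tgt N e) - k (src N e))
    - capacity N e * lam (tgt N e)
      * Num.max (k (tgt N e) - k (src N e) - transit N e) 0).
Proof. by move=> rf; rewrite sumrB /potential -(regular_balance rf k) addrK. Qed.

(** Weak duality: the flow is primal feasible and its cost bounds the dual objective. *)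
Lemma potential_le A B x k : regular_flow N A B lam x ->
  potential k <= \sum_e x e * transit N e.
Proof.
move=> rf; rewrite (potential_flow k rf); apply: ler_sum => e _.
have := regular_capacity rf e; have := regular_ge0 rf e.
set K := k _ - k _; set c := capacity N e * _ => x0 xc.
have : x e * Num.max (K - transit N e) 0 <= c * Num.max (K - transit N e) 0.
  by rewrite ler_wpM2r// le_max lexx orbT.
have : x e * (K - transit N e) <= x e * Num.max (K - transit N e) 0.
  by rewrite ler_wpM2l// le_max lexx.
by rewrite mulrBr; lra.
Qed.

(** Complementary slackness: resetting arcs are saturated and inactive arcs are empty, so the
    duality gap closes. *)
Lemma potential_active l x :
  regular_flow N (active_arcs N l) (resetting_arcs N l) lam x ->
  potential l = \sum_e x e * transit N e.
Proof.
move=> rf; rewrite (potential_flow l rf); apply: eq_bigr => e _.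
have := regular_resetting rf (e := e); rewrite inE.
case: (ltP (transit N e) (l (tgt N e) - l (src N e))) => h.
  by move=> /(_ isT) <-; rewrite max_l ?subr_ge0 ?ltW//; ring.
move=> _; rewrite max_r ?subr_le0// mulr0 subr0.
have := regular_ge0 rf e; rewrite le_eqVlt => /orP[/eqP <-|/(regular_support rf)].
  by rewrite !mul0r.
by rewrite inE => h2; congr (_ * _); apply/eqP; rewrite eq_le h.
Qed.

Section Rate.
Variables (A B : {set E}) (p : V -> R) (x : E -> R).
Hypothesis rf : regular_flow N A B p x.
Hypothesis Bp : forall e, e \in B -> 0 < p (tgt N e).

(** The loss from replacing the capacity [nu_e] by the inflow rate [x_e / p_w] of the arc; on an arc
    with [lam_v < lam_w] it vanishes only at full rate. *)
Definition slack e : R :=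
  capacity N e * lam (tgt N e) * Num.max (lam (tgt N e) - lam (src N e)) 0
  - x e / p (tgt N e) * lam (tgt N e) * (lam (tgt N e) - lam (src N e)).

Lemma slack_ge0 e : 0 <= slack e.
Proof.
rewrite /slack subr_ge0; set d := lam _ - lam _.
apply: (@le_trans _ _ (x e / p (tgt N e) * lam (tgt N e) * Num.max d 0)).
  rewrite ler_wpM2l ?le_max ?lexx// mulr_ge0 ?(rate_ge0 rf)//.
  exact/ltW/(steady_gt0 HN Hlam).
rewrite ler_wpM2r ?le_max ?lexx ?orbT// ler_wpM2r//.
  exact/ltW/(steady_gt0 HN Hlam).
exact: (rate_le_capacity HN rf).
Qed.

(** This is [gap_sum] for [n = lam], where [steady_identity] turns the remaining terms into the
    slacks. *)
Lemma potential_rateE : potential_rate A B p =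
  \sum_e arc_gap N p x lam e + \sum_(s : source N) source_gap p lam s + sink_gap N p lam
  + \sum_e slack e.
Proof.
rewrite -(gap_sum rf Bp lam) /potential_rate sumrB.
by rewrite -(steady_identity HN Hlam); ring.
Qed.

Hypothesis mono : forall e, 0 < x e -> lam (src N e) <= lam (tgt N e).

Let gap_ge0 : [/\ forall e, 0 <= arc_gap N p x lam e,
  forall s : source N, 0 <= source_gap p lam s & 0 <= sink_gap N p lam].
Proof.
have lam0 := steady_gt0 HN Hlam.
split; first exact: (arc_gap_ge0 HN rf lam0 mono).
  exact: (source_gap_ge0 HN rf lam0).
exact: (sink_gap_ge0 HN rf lam0).
Qed.

Lemma potential_rate_ge0 : 0 <= potential_rate A B p.
Proof.
have [H1 H2 H3] := gap_ge0; rewrite potential_rateE.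
by rewrite !addr_ge0// sumr_ge0// => e _; exact: slack_ge0.
Qed.

Lemma potential_rate_le0 : potential_rate A B p <= 0 ->
  [/\ forall e, arc_gap N p x lam e = 0, forall s : source N, source_gap p lam s = 0
    & forall e, slack e = 0].
Proof.
have [H1 H2 H3] := gap_ge0; rewrite potential_rateE => r0.
have s1 : 0 <= \sum_e arc_gap N p x lam e by rewrite sumr_ge0.
have s2 : 0 <= \sum_(s : source N) source_gap p lam s by rewrite sumr_ge0.
have s3 : 0 <= \sum_e slack e by rewrite sumr_ge0// => e _; exact: slack_ge0.
have sum0 (I : finType) (F : I -> R) : (forall i, 0 <= F i) -> \sum_i F i <= 0 ->
    forall i, F i = 0.
  move=> F0 sF i; apply/eqP; rewrite -oppr_eq0; apply/eqP.
  apply: (@sum_le0_eq0 R I (fun i => - F i)) => [j|]; first by rewrite oppr_le0.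
  by rewrite sumrN oppr_ge0.
by split; apply: sum0 => //; [lra|lra|exact: slack_ge0|lra].
Qed.

End Rate.

Lemma thin_direction_regular l p : feasible N l -> thin_direction N l p ->
  exists x, [/\ thin_flow (N := N) (active_arcs N l) (resetting_arcs N l) p x,
    regular_flow N (active_arcs N l) (resetting_arcs N l) p (fun e => x (inl e))
    & forall e, e \in resetting_arcs N l -> 0 < p (tgt N e)].
Proof.
move=> fl td; have [[x tf] _] := td.
have p0 := maximal_label_ge0 HN td.
exists x; split => //; first exact: (thin_flow_regular HN tf p0 (active_resettingS _ _)).
exact: (resetting_label_gt0 HN fl tf p0).
Qed.

Section Settled.
Variables l p : V -> R.
Hypothesis fl : feasible N l.
Hypothesis td : thin_direction N l p.
Hypothesis mono :
  forall e, e \in active_arcs N l -> lam (src N e) <= lam (tgt N e).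
Hypothesis rate0 : potential_rate (active_arcs N l) (resetting_arcs N l) p <= 0.

(* All gaps vanish, so [p / lam] is constant along the flow and [p <= lam].  The set
   [Z] where [p] and [lam] differ carries only circulations; deleting them yields
   a thin flow with label vector [lam], whence [lam <= p]. *)
Lemma potential_rate0_steady v : p v = lam v.
Proof.
have [x [tf rf Bp]] := thin_direction_regular fl td.
have lam0 := steady_gt0 HN Hlam.
have xmono e : 0 < x (inl e) -> lam (src N e) <= lam (tgt N e).
  by move=> /(regular_support rf); exact: mono.
have [G1 G2 G3] := potential_rate_le0 rf Bp xmono rate0.
have p0 := regular_label_ge0 rf.
have nu0 e : 0 < capacity N e by exact: (capacity_gt0 HN).
have x0 e : 0 <= x (inl e) by exact: (regular_ge0 rf e).
have ps (s : source N) : p (val s) = lam (val s).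
  apply: log_source_gap_eq0 => //; move/eqP: (G2 s); rewrite /source_gap mulf_eq0.
  by rewrite gt_eqF ?(inflow_pos HN)// => /eqP.
have ratio e : 0 < x (inl e) ->
    p (tgt N e) / lam (tgt N e) = p (src N e) / lam (src N e).
  by move=> xe; have [] := arc_gap_eq0 HN rf lam0 xmono xe (G1 e).
(* An empty arc going up would have positive slack; once it carries flow, its vanishing arc gap
   fixes the label of its head. *)
have up e : lam (src N e) < lam (tgt N e) ->
    0 < x (inl e) /\ p (tgt N e) = lam (tgt N e).
  move=> le; suff xe : 0 < x (inl e).
    by split => //; have [_] := arc_gap_eq0 HN rf lam0 xmono xe (G1 e); exact.
  rewrite lt_neqAle x0 andbT eq_sym; apply/negP => /eqP xe.
  move/eqP: (G3 e); rewrite /slack xe !mul0r subr0 max_l ?subr_ge0 ?ltW//.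
  by rewrite gt_eqF// !mulr_gt0 ?subr_gt0.
have reset_pos e : e \in resetting_arcs N l -> 0 < x (inl e).
  by move=> eB; rewrite (regular_resetting rf eB) mulr_gt0// Bp.
(* The bound spreads from the sources along active arcs: a carrying arc keeps the ratio [p / lam],
   and an empty one has [p_w <= p_v <= lam_v <= lam_w]. *)
have ple u : p u <= lam u.
  have [s sS [q /andP[qw _]]] := feasible_reachable fl u.
  apply: (walk_invariant (Q := fun u => p u <= lam u) _ qw) => [e eA pv|]; last first.
    by have := ps (exist _ s sS) => /= ->.
  have [xe|xe] : x (inl e) = 0 \/ 0 < x (inl e).
  + by have := x0 e; rewrite le_eqVlt => /orP[/eqP <-|]; [left|right].
  + have := thin_flow_le tf eA; rewrite /rho xe mul0r; case: ifP => [/reset_pos|_].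
      by rewrite xe ltxx.
    by rewrite max_l// => h; rewrite (le_trans h)// (le_trans pv)// mono.
  + rewrite -[p _](@divfK _ (lam (tgt N e))) ?gt_eqF// ratio// ler_piMl ?(ltW (lam0 _))//.
    by rewrite ler_pdivrMr// mul1r.
apply/eqP; rewrite eq_le ple/=.
pose Z := [set u | p u != lam u]%SET.
have inZ e : 0 < x (inl e) -> (tgt N e \in Z) = (src N e \in Z).
  have eq1 u : (p u == lam u) = (p u / lam u == 1).
    rewrite -[RHS](inj_eq (mulIf (lt0r_neq0 (lam0 u)))) /= mul1r divfK//.
    exact: lt0r_neq0.
  by move=> /ratio r; rewrite !inE !eq1 r.
have cross e : (tgt N e \in Z) != (src N e \in Z) -> x (inl e) = 0.
  move=> h; apply/eqP; rewrite eq_le x0 andbT leNgt; apply/negP => /inZ eq.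
  by rewrite eq eqxx in h.
have sZ (s : source N) : val s \notin Z by rewrite inE ps eqxx.
have srcZ (k : V -> R) : \sum_(s : source N)
    inflow N (val s) * p (val s) * (k (val s) * indicator R Z (val s)) = 0.
  by apply: big1 => s _; rewrite /indicator (negbTE (sZ s)) !mulr0.
have tZ : sink N \notin Z.
  apply/negP => tZ; have := regular_balance rf (fun v => 1 * indicator R Z v).
  rewrite (srcZ (fun=> 1)) addr0 big1 => [|e _].
    by rewrite /indicator tZ !mulr1 => /eqP; rewrite eq_sym gt_eqF// total_inflow_gt0.
  have [eq|/cross ->] := eqVneq (tgt N e \in Z) (src N e \in Z).
    by rewrite /indicator eq subrr mulr0.
  by rewrite mul0r.
(* The flow within [Z] is a circulation, so its total gain in [l] is zero. Active arcs never lose,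
   and a resetting arc, which carries flow, would gain strictly. *)
have noreset e : e \in resetting_arcs N l -> tgt N e \notin Z.
  move=> eB; have xe := reset_pos e eB; apply/negP => wZ.
  have vZ : src N e \in Z by rewrite -inZ.
  have := regular_balance rf (fun v => l v * indicator R Z v).
  have -> : indicator R Z (sink N) = 0 by rewrite /indicator (negbTE tZ).
  rewrite (srcZ l) addr0 !mulr0 => /eqP; rewrite psumr_eq0 => [|f _].
    move/allP/(_ e); rewrite mem_index_enum => /(_ isT).
    rewrite /indicator wZ vZ !mulr1 mulf_eq0 gt_eqF//= gt_eqF//.
    by move: eB; rewrite inE; apply: le_lt_trans; exact: (transit_ge0 HN).
  have [eq|/cross ->] := eqVneq (tgt N f \in Z) (src N f \in Z); last by rewrite mul0r.
  rewrite /indicator eq -mulrBl; case: (_ \in Z); last by rewrite !mulr0.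
  rewrite mulr1; have := x0 f; rewrite le_eqVlt => /orP[/eqP <-|xf].
    by rewrite mul0r.
  rewrite mulr_ge0//; have := regular_support rf xf; rewrite inE.
  by apply: le_trans; exact: (transit_ge0 HN).
(* Arcs between [Z] and its complement carry nothing, so erasing the flow on arcs that start in [Z]
   erases exactly the circulation inside. *)
pose y (a : xarc N) := match a with
  | inl e => if src N e \in Z then 0 else x (inl e) | inr s => x (inr s) end.
have [stx0 stxc stxv] := thin_flow_static tf.
have netE o : (forall u, u \in Z -> o <> Some u) -> net_outflow y o = net_outflow x o.
  move=> oZ; rewrite /net_outflow; congr (_ - _); apply: eq_bigr => -[e|s]//= /eqP eo.
    by case: ifP => // /oZ; rewrite eo.
  case: ifPn => // vZ; rewrite cross// vZ; apply/negP => /eqP wZ.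
  by have := oZ (tgt N e); rewrite wZ => /(_ isT); rewrite eo.
have ty : thin_flow (active_arcs N l) (resetting_arcs N l) lam y.
  split.
  - split.
    + by move=> [e|s] /=; first by case: ifP.
    + move=> [u|]// _ ut; have [uZ|uZ] := boolP (u \in Z); last first.
        rewrite netE ?stxc// => w wZ [uw]; by rewrite uw wZ in uZ.
      rewrite /net_outflow !big1 ?subrr// => -[e|s]//= /eqP[eu].
      * by case: ifPn => // vZ; rewrite cross// eu uZ (negbTE vZ).
      * by move: uZ; rewrite -eu (negbTE (sZ s)).
      * by rewrite eu uZ.
    + by rewrite netE// => u _.
  - by move=> e eA /=; rewrite (thin_flow_support tf eA); case: ifP.
  - by move=> s /=; rewrite -ps (thin_flow_source tf).
  (* An arc with an end in [Z] cannot go up in [lam]: by [up] its head would lie outside [Z], and so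
     would its tail, since the arc carries flow. *)
  - move=> e eA /=; have [vZ|vZ] := boolP (src N e \in Z).
      rewrite /rho mul0r; case: ifPn => eB.
        by have := noreset e eB; rewrite (inZ _ (reset_pos e eB)) vZ.
      rewrite max_l ?(ltW (lam0 _))// leNgt; apply/negP => /up[xe pe].
      by move: vZ; rewrite -inZ// inE pe eqxx.
    have [wZ|wZ] := boolP (tgt N e \in Z).
      have eB : e \notin resetting_arcs N l.
        by apply/negP => /noreset; rewrite wZ.
      rewrite /rho (negbTE eB) le_max leNgt; apply/orP; left; apply/negP => /up[_ pe].
      by move: wZ; rewrite inE pe eqxx.
    have := thin_flow_le tf eA.
    by move: vZ wZ; rewrite !inE !negbK => /eqP -> /eqP ->.
  - move=> e eA /=; have [vZ|vZ] := boolP (src N e \in Z); first by rewrite ltxx.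
    move=> xe; have := thin_flow_eq tf eA xe.
    have : tgt N e \notin Z by rewrite inZ.
    by move: vZ; rewrite !inE !negbK => /eqP -> /eqP ->.
by have [_ /(_ _ _ ty v)] := td.
Qed.

(** Since the direction at [l] is [lam], its flow certifies optimality of [l] by complementary
    slackness. *)
Lemma potential_rate0_max k : potential k <= potential l.
Proof.
have [x [tf rf Bp]] := thin_direction_regular fl td.
have pE : p = lam by apply/funext; exact: potential_rate0_steady.
rewrite pE in rf; rewrite (potential_active rf); exact: (potential_le k rf).
Qed.

End Settled.
End Potential.

(** * The energy *)

Section Cluster.
Local Open Scope classical_set_scope.
Variable R : realType.

(** An ultrafilter on late times of [B] converges in all coordinates at once by compactness, which
    replaces extracting subsequences. *)
Lemma bounded_cluster (V : finType) (B : R -> Prop) (n : R -> V -> R) M :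
  (forall T, exists theta, T <= theta /\ B theta) ->
  (forall theta v, B theta -> - M <= n theta v <= M) ->
  exists2 G : set_system R, ProperFilter G &
    [/\ G B, forall T, G [set theta | T <= theta] &
    exists m : V -> R, forall v, (fun theta => n theta v) @ G --> m v].
Proof.
move=> Bunb nM.
pose F : set_system R := fun A => exists T, forall theta, T <= theta -> B theta -> A theta.
have FF : ProperFilter F.
  apply: Build_ProperFilter_ex.
    by move=> A [T HT]; have [th [h1 h2]] := Bunb T; exists th; exact: HT.
  split.
  - by exists 0.
  - move=> P Q [T1 H1] [T2 H2]; exists (Num.max T1 T2) => th.
    by rewrite ge_max => /andP[h1 h2] Bth; split; [exact: H1|exact: H2].
  - by move=> P Q PQ [T HT]; exists T => th h1 h2; apply: PQ; exact: HT.
have [G [GU FG]] := ultraFilterLemma FF.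
have GF : ProperFilter G := ultra_proper.
exists G; first exact: GF.
split.
- by apply: FG; exists 0.
- by move=> T; apply: FG; exists T.
suff lim v : exists m : R, (fun theta => n theta v) @ G --> m.
  by exists (fun v => projT1 (cid (lim v))) => v; exact: (projT2 (cid (lim v))).
have GM : G ((fun theta => n theta v) @^-1` `[- M, M]).
  by apply: FG; exists 0 => th _ Bth; rewrite /= in_itv /=; exact: nM.
have [m [_ mc]] := @segment_compact R (- M) M ((fun theta => n theta v) @ G) _ GM.
exists m => U mU; rewrite /nbhs /=.
have [//|GC] := in_ultra_setVsetC ((fun theta => n theta v) @^-1` U) GU.
by have [z [zC zU]] := mc (~` U) U GC mU.
Qed.

Lemma right_derivative_inv1D (x : R) : 0 <= x ->
  right_derivative (fun y => (y + 1)^-1) x (- (x + 1)^-1 ^+ 2).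
Proof.
move=> x0; have x1 : x + 1 != 0 by rewrite gt_eqF//; lra.
have : (fun h => - ((x + h + 1)^-1 * (x + 1)^-1)) @ (0:R)^'+ -->
       - ((x + 1)^-1 * (x + 1)^-1).
  apply: cvgN; apply: cvgM; last exact: cvg_cst.
  apply: cvgV => //.
  have -> : (fun h : R => x + h + 1) = (fun h => x + 1 + h) by apply/funext => h; ring.
  rewrite -[X in _ --> X]addr0; apply: cvgD; first exact: cvg_cst.
  by apply: cvg_at_right_filter; exact: cvg_id.
rewrite expr2; apply: cvg_trans; apply: near_eq_cvg; near=> h.
have h0 : 0 < h by [].
by field; rewrite !gt_eqF//; lra.
Unshelve. all: by end_near. Qed.

Lemma right_derivative_ln1D (x : R) : 0 <= x ->
  right_derivative (fun y => ln (y + 1)) x (x + 1)^-1.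
Proof.
move=> x0; have x1 : 0 < x + 1 by lra.
have [dl lE] := is_derive1_ln x1.
have H := derivable_right_derivative dl.
rewrite derive1E lE in H.
move: H; rewrite /right_derivative.
suff -> : (fun h : R => h^-1 * (ln (x + 1 + h) - ln (x + 1))) =
  (fun h => h^-1 * (ln (x + h + 1) - ln (x + 1))) by [].
by apply/funext => h; rewrite addrAC.
Qed.

End Cluster.

Section Energy.
Variables (R : realType) (V E : finType) (N : network R V E).
Hypothesis HN : network_axioms N.
Implicit Types (e : E) (l p k : V -> R).

Definition queue k e : R :=
  Num.max (k (tgt N e) - k (src N e) - transit N e) 0.

Definition energy k (th : R) : R :=
  \sum_e capacity N e * k (tgt N e) * queue k e
  + \sum_(s : source N) inflow N (val s) * k (val s) ^+ 2
  - total_inflow N * (th * k (sink N)).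

Definition energy_rate A B k p (th : R) : R :=
  \sum_e capacity N e * (p (tgt N e) * queue k e + k (tgt N e) * queue_rate N A B p e)
  + \sum_(s : source N) inflow N (val s) * (2 * k (val s) * p (val s))
  - total_inflow N * (1 * k (sink N) + th * p (sink N)).

Lemma queue_rate_pos k p e :
  pos_right_derivative (k (tgt N e) - k (src N e) - transit N e)
    (p (tgt N e) - p (src N e))
  = queue_rate N (active_arcs N k) (resetting_arcs N k) p e.
Proof.
rewrite /pos_right_derivative /queue_rate !inE subr_gt0 subr_eq0.
by case: ltgtP.
Qed.

(** Half of the derivative is nonpositive by flow balance tested with [k]; the other half is bounded
    by [master_inequality] for [n = k / th]. Consequently [energy / th] grows at rate at most a
    constant over [th]. *)
Lemma energy_rate_le k p x (th M : R) : 0 < th ->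
  (forall v, 0 < k v) -> (forall v, k v <= M * th) ->
  regular_flow N (active_arcs N k) (resetting_arcs N k) p x ->
  (forall e, e \in resetting_arcs N k -> 0 < p (tgt N e)) ->
  energy_rate (active_arcs N k) (resetting_arcs N k) k p th <=
  energy k th / th + \sum_e capacity N e * M * transit N e.
Proof.
move=> th0 k0 kM rf Bp.
have nu0 e : 0 < capacity N e by exact: (capacity_gt0 HN).
have q0 e : 0 <= queue k e by rewrite /queue le_max lexx orbT.
have x0 e : 0 <= x e by exact: (regular_ge0 rf e).
have xq e : 0 < x e -> k (tgt N e) - k (src N e) = queue k e + transit N e.
  by move/(regular_support rf); rewrite inE => h; rewrite /queue max_l; lra.
(* Arcs with a queue are saturated, and on carrying arcs the label difference is the queueing delay
   plus the transit time. *)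
have S1 : \sum_e capacity N e * (p (tgt N e) * queue k e)
  + \sum_(s : source N) inflow N (val s) * p (val s) * k (val s)
  <= total_inflow N * k (sink N).
  rewrite -(regular_balance rf k) lerD2r; apply: ler_sum => e _.
  have -> : capacity N e * (p (tgt N e) * queue k e) = x e * queue k e.
    have := regular_resetting rf (e := e); rewrite inE /queue.
    case: ltP => h; first by move=> /(_ isT) ->; rewrite mulrA.
    by move=> _; rewrite max_r ?mulr0//; lra.
  have := x0 e; rewrite le_eqVlt => /orP[/eqP <-|xe]; first by rewrite !mul0r.
  by rewrite ler_pM2l// xq// lerDl (transit_ge0 HN).
pose n v := k v / th.
have n0 v : 0 < n v by rewrite divr_gt0.
have nth v : k v = th * n v by rewrite /n mulrC divfK// gt_eqF.
have nM v : n v <= M by rewrite ler_pdivrMr.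
have M0 : 0 <= M := le_trans (ltW (n0 (sink N))) (nM _).
have nmono e : 0 < x e -> n (src N e) <= n (tgt N e).
  move=> /xq h; rewrite ler_pM2r ?invr_gt0//.
  by have := q0 e; have := transit_ge0 HN e; lra.
have := master_inequality HN rf Bp n0 nmono.
rewrite -(ler_pM2l th0) => S2.
(* Inflow rates are at most [nu_e], and the transit times contribute only a bounded error because
   [n <= M]. *)
have S3 : th * \sum_e x e / p (tgt N e) * n (tgt N e) * (n (tgt N e) - n (src N e)) <=
  \sum_e capacity N e * n (tgt N e) * queue k e + \sum_e capacity N e * M * transit N e.
  rewrite mulr_sumr -big_split; apply: ler_sum => e _ /=.
  have -> : th * (x e / p (tgt N e) * n (tgt N e) * (n (tgt N e) - n (src N e))) =
    x e / p (tgt N e) * n (tgt N e) * (k (tgt N e) - k (src N e)).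
    by rewrite !nth; ring.
  have := x0 e; rewrite le_eqVlt => /orP[/eqP <-|xe].
    have nu0e := ltW (nu0 e); have n0e := ltW (n0 (tgt N e)).
    have t0e := transit_ge0 HN e.
    by rewrite !mul0r; apply: addr_ge0; apply: mulr_ge0 => //; apply: mulr_ge0.
  have r1 := rate_le_capacity HN rf e.
  have t0 := transit_ge0 HN e.
  have q0e := q0 e.
  rewrite xq//; apply: (@le_trans _ _ (capacity N e * n (tgt N e) * (queue k e + transit N e))).
    by rewrite ler_wpM2r ?addr_ge0// ler_wpM2r// ltW.
  rewrite mulrDr lerD2l ler_wpM2r// ler_pM2l//.
have S4 : th * \sum_e capacity N e * n (tgt N e) * queue_rate N (active_arcs N k) (resetting_arcs N k) p e
  = \sum_e capacity N e * (k (tgt N e) * queue_rate N (active_arcs N k) (resetting_arcs N k) p e).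
  by rewrite mulr_sumr; apply: eq_bigr => e _; rewrite [k (tgt N e)]nth; ring.
have S5 : th * \sum_(s : source N) inflow N (val s) * n (val s) * p (val s)
  = \sum_(s : source N) inflow N (val s) * p (val s) * k (val s).
  by rewrite mulr_sumr; apply: eq_bigr => s _; rewrite [k (val s)]nth; ring.
have S6 : \sum_(s : source N) inflow N (val s) * (2 * k (val s) * p (val s)) =
  2 * \sum_(s : source N) inflow N (val s) * p (val s) * k (val s).
  by rewrite mulr_sumr; apply: eq_bigr => s _; ring.
have S7 : energy k th / th = \sum_e capacity N e * n (tgt N e) * queue k e
  + th * \sum_(s : source N) inflow N (val s) * n (val s) ^+ 2
  - total_inflow N * (th * n (sink N)).
  rewrite /energy mulrBl mulrDl mulr_suml mulr_sumr mulr_suml; congr (_ + _ - _).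
  - by apply: eq_bigr => e _; rewrite /n; ring.
  - by apply: eq_bigr => s _; rewrite [k (val s)]nth; field; rewrite gt_eqF.
  - by rewrite -nth; field; rewrite gt_eqF.
have S8 : \sum_e capacity N e * (p (tgt N e) * queue k e
     + k (tgt N e) * queue_rate N (active_arcs N k) (resetting_arcs N k) p e) =
  \sum_e capacity N e * (p (tgt N e) * queue k e) +
  \sum_e capacity N e * (k (tgt N e) * queue_rate N (active_arcs N k) (resetting_arcs N k) p e).
  by rewrite -big_split; apply: eq_bigr => e _; rewrite mulrDr.
rewrite /energy_rate S6 S7 S8; move: S2; rewrite mulrBr mulrDr S4 S5 mulrBr mulrDr.
by lra.
Qed.

End Energy.

(** * Uniform bounds over the finitely many thin flow configurations *)

Section FiniteConfigurations.
Variables (R : realType) (V E : finType) (N : network R V E).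
Hypothesis HN : network_axioms N.
Implicit Types (A B : {set E}) (p : V -> R).

Lemma maximal_label_unique A B p q :
  maximal_label N A B p -> maximal_label N A B q -> p = q.
Proof.
move=> [[x px] pm] [[y qy] qm]; apply/funext => v.
by apply/eqP; rewrite eq_le (qm _ _ px) (pm _ _ qy).
Qed.

Lemma maximal_label_bound : exists2 M, 0 <= M &
  forall A B p, maximal_label N A B p -> forall v, p v <= M.
Proof.
(* Each pair of arc sets has at most one label vector. The upper bound is obtained as the reciprocal
   of a common positive lower bound. *)
have [| |c c0 Hc] := @finite_lower_bound R _ (fun (i : {set E} * {set E}) c =>
    forall p, maximal_label N i.1 i.2 p -> forall v, p v * c <= 1).
- move=> i c d dc H p pm v; apply: le_trans (H _ pm v).
  by rewrite ler_wpM2l// (maximal_label_ge0 HN pm).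
- move=> i; have [[p pm]|np] := pselect (exists p, maximal_label N i.1 i.2 p).
    have p0 := maximal_label_ge0 HN pm.
    have s0 : 0 < 1 + \sum_v p v by rewrite ltr_pwDl// sumr_ge0.
    exists (1 + \sum_v p v)^-1; first by rewrite invr_gt0.
    move=> q qm v; rewrite -(maximal_label_unique pm qm) ler_pdivrMr// mul1r.
    rewrite (bigD1 v)//= addrCA lerDl addr_ge0// sumr_ge0//.
  by exists 1 => // p pm; exfalso; apply: np; exists p.
exists c^-1; first by rewrite invr_ge0 ltW.
move=> A B p pm v; rewrite -[c^-1]mul1r ler_pdivlMr//; exact: (Hc (A, B)).
Qed.

(** Only finitely many rates occur, so the positive ones are bounded away from [0]. *)
Lemma potential_rate_gap lam : exists2 c, 0 < c &
  forall A B p, maximal_label N A B p -> 0 < potential_rate N lam A B p ->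
    c <= potential_rate N lam A B p.
Proof.
have [| |c c0 Hc] := @finite_lower_bound R _ (fun (i : {set E} * {set E}) c =>
    forall p, maximal_label N i.1 i.2 p -> 0 < potential_rate N lam i.1 i.2 p ->
      c <= potential_rate N lam i.1 i.2 p).
- by move=> i c d dc H p pm r0; apply: le_trans (H _ pm r0).
- move=> i.
  have [[p [pm r0]]|np] := pselect (exists p, maximal_label N i.1 i.2 p /\
      0 < potential_rate N lam i.1 i.2 p).
    by exists (potential_rate N lam i.1 i.2 p) => // q qm _;
      rewrite (maximal_label_unique pm qm).
  by exists 1 => // p pm r0; exfalso; apply: np; exists p.
exists c => // A B p; exact: (Hc (A, B)).
Qed.

End FiniteConfigurations.

(** * Nonnegativity and continuity of the cut functional *)

Section CutLimits.
Variables (R : realType) (V E : finType) (N : network R V E).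

(** A flow of value [u_0] fits into the capacities [nu_e p_w]; subtracting its balance leaves
    nonnegative terms. *)
Lemma regular_cut_ge0 (A B : {set E}) p x c : regular_flow N A B p x ->
  0 <= cut_functional N p c.
Proof.
move=> rf; rewrite /cut_functional -(regular_balance rf c) opprD addrACA subrr addr0 -sumrB.
apply: sumr_ge0 => e _; rewrite subr_ge0.
have := regular_capacity rf e; have := regular_ge0 rf e => x0 xc.
apply: (@le_trans _ _ (x e * Num.max (c (tgt N e) - c (src N e)) 0)).
  by rewrite ler_wpM2l// le_max lexx.
by rewrite ler_wpM2r// le_max lexx orbT.
Qed.

Lemma cvg_bigsum (T : Type) (I : finType) (G : set_system T) (FG : ProperFilter G)
    (F : I -> T -> R) (L : I -> R) : (forall i, (F i @ G --> L i)%classic) ->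
  ((fun t => \sum_i F i t) @ G --> \sum_i L i)%classic.
Proof.
move=> FL; elim: (index_enum I) => [|i s IH].
  have -> : (fun t => \sum_(i <- [::]) F i t) = fun=> 0.
    by apply/funext => t; rewrite big_nil.
  by rewrite big_nil; exact: cvg_cst.
have -> : (fun t => \sum_(j <- i :: s) F j t) =
          (fun t => F i t + \sum_(j <- s) F j t).
  by apply/funext => x; rewrite big_cons.
by rewrite big_cons; exact: cvgD.
Qed.

Lemma cut_functional_cvg (T : Type) (G : set_system T) (FG : ProperFilter G)
    (n c : T -> V -> R) (m d : V -> R) :
  (forall v, (n^~ v @ G --> m v)%classic) -> (forall v, (c^~ v @ G --> d v)%classic) ->
  ((fun t => cut_functional N (n t) (c t)) @ G --> cut_functional N m d)%classic.
Proof.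
move=> nm cd; apply: cvgB; last by apply: cvgM; [exact: cvg_cst|exact: cd].
apply: cvgD; apply: cvg_bigsum => i; apply: cvgM => //.
- by apply: cvgM; [exact: cvg_cst|exact: nm].
- have mc a : ((fun y : R => Num.max y 0) @ a --> Num.max a 0)%classic.
    by apply: (@continuous_max R R id (cst 0)); [exact: cvg_id|exact: cvg_cst].
  by apply: cvg_comp (mc _); apply: cvgB.
- by apply: cvgM; [exact: cvg_cst|exact: nm].
Qed.

End CutLimits.

(** * Equilibrium trajectories *)

Section Trajectory.
Variables (R : realType) (V E : finType) (N : network R V E).
Hypothesis HN : network_axioms N.
Variable ell : R -> V -> R.
Hypothesis Hell : equilibrium_trajectory N ell.
Implicit Types (e : E) (v w : V) (A B : {set E}) (p k c : V -> R) (theta : R).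

Definition moves_along theta p : Prop :=
  [/\ feasible N (ell theta), thin_direction N (ell theta) p &
      forall v, right_derivative (ell^~ v) theta (p v)].

Lemma moves_along_ae : {ae @lebesgue_measure R, forall theta, 0 <= theta ->
  exists p, moves_along theta p}.
Proof.
apply: ae_imply (trajectory_direction Hell) => theta H theta0.
have [dl td] := H theta0; exists (fun v => derive1 (ell^~ v) theta); split.
- exact: (trajectory_feasible Hell).
- exact: td.
- by move=> v; exact: (derivable_right_derivative (dl v)).
Qed.

Lemma moves_along_monotone f a : locally_lipschitz f -> 0 <= a ->
  (forall theta p, a <= theta -> moves_along theta p ->
     exists2 d, right_derivative f theta d & 0 <= d) ->
  forall x y, a <= x -> x <= y -> f x <= f y.
Proof.
move=> fl a0 H; apply: locally_lipschitz_nondecreasing => //.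
apply: ae_imply moves_along_ae => theta Hth ath.
by have [|p mp] := Hth; [exact: le_trans ath|exact: H mp].
Qed.

Lemma trajectory_growth : exists2 M, 0 <= M & forall v x y, 0 <= x -> x <= y ->
  0 <= ell y v - ell x v <= M * (y - x).
Proof.
have [M M0 HM] := maximal_label_bound HN; exists M => // v.
apply: ac_lipschitz => [b b0|]; first exact: (trajectory_ac Hell).
apply: ae_imply moves_along_ae => theta Hth ath.
have [p [_ td rd]] := Hth ath; exists (p v) => //.
by rewrite (maximal_label_ge0 HN td) (HM _ _ _ td).
Qed.

Lemma trajectory_lipschitz v : locally_lipschitz (ell^~ v).
Proof.
have [M M0 HM] := trajectory_growth => b b0; exists M => // x y x0 xy _.
by have /andP[h1 h2] := HM v x y x0 xy; rewrite ger0_norm.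
Qed.

Section Shift.
Variable C : R.
(** A common shift leaves differences, hence active arcs and queues, unchanged. It is used to make
    all labels positive, as the logarithms require. *)
Let k theta v : R := ell theta v + C.

Lemma shiftB theta v w : k theta w - k theta v = ell theta w - ell theta v.
Proof. by rewrite /k; ring. Qed.

Lemma active_shift theta : active_arcs N (k theta) = active_arcs N (ell theta).
Proof. by apply/finset.setP => e; rewrite !inE shiftB. Qed.

Lemma resetting_shift theta : resetting_arcs N (k theta) = resetting_arcs N (ell theta).
Proof. by apply/finset.setP => e; rewrite !inE shiftB. Qed.

Lemma shift_lipschitz v : locally_lipschitz (k^~ v).
Proof. exact: locally_lipschitzD (trajectory_lipschitz v) (locally_lipschitz_cst C). Qed.

Lemma shift_right_derivative theta p v : moves_along theta p ->
  right_derivative (k^~ v) theta (p v).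
Proof.
move=> [_ _ rd]; rewrite -[p v]addr0.
exact: right_derivativeD (rd v) (right_derivative_cst C theta).
Qed.

Lemma queue_lipschitz e : locally_lipschitz (fun theta => queue N (k theta) e).
Proof.
apply: locally_lipschitz_pos; apply: locally_lipschitzB; last exact: locally_lipschitz_cst.
exact: locally_lipschitzB (shift_lipschitz _) (shift_lipschitz _).
Qed.

Lemma queue_right_derivative e theta p : moves_along theta p ->
  right_derivative (fun theta => queue N (k theta) e) theta
    (queue_rate N (active_arcs N (ell theta)) (resetting_arcs N (ell theta)) p e).
Proof.
move=> mp; rewrite -active_shift -resetting_shift -queue_rate_pos.
have H : right_derivative (fun theta => k theta (tgt N e) - k theta (src N e) - transit N e)
    theta (p (tgt N e) - p (src N e) - 0).
  apply: right_derivativeB; last exact: right_derivative_cst.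
  exact: (right_derivativeB (shift_right_derivative (v := tgt N e) mp)
    (shift_right_derivative (v := src N e) mp)).
rewrite subr0 in H; exact: right_derivative_pos H.
Qed.

(** Averages are taken over [theta + 1], which avoids the singularity at time [0]. *)
Lemma time_lipschitz : locally_lipschitz (fun theta : R => theta + 1).
Proof.
apply: locally_lipschitzD; [exact: locally_lipschitz_id|exact: locally_lipschitz_cst].
Qed.

Lemma time_right_derivative theta : right_derivative (fun theta : R => theta + 1) theta 1.
Proof.
rewrite -[X in right_derivative _ _ X]addr0.
exact: right_derivativeD (right_derivative_id theta) (right_derivative_cst 1 theta).
Qed.

Lemma energy_lipschitz : locally_lipschitz (fun theta => energy N (k theta) (theta + 1)).
Proof.
rewrite /energy; apply: locally_lipschitzB; last first.
  apply: locally_lipschitzZ; apply: locally_lipschitzM; first exact: time_lipschitz.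
  exact: shift_lipschitz.
apply: locally_lipschitzD; apply: locally_lipschitz_sum => i.
  apply: locally_lipschitzM; last exact: queue_lipschitz.
  exact: locally_lipschitzZ (shift_lipschitz _).
apply: locally_lipschitzZ.
exact: locally_lipschitzM (shift_lipschitz _) (shift_lipschitz _).
Qed.

Lemma energy_right_derivative theta p : moves_along theta p ->
  right_derivative (fun theta => energy N (k theta) (theta + 1)) theta
    (energy_rate N (active_arcs N (ell theta)) (resetting_arcs N (ell theta))
       (k theta) p (theta + 1)).
Proof.
move=> mp; have sh v := shift_right_derivative (v := v) mp.
rewrite /energy /energy_rate; apply: right_derivativeB; last first.
  apply: right_derivativeZ; apply: right_derivativeM; first exact: time_right_derivative.
  exact: sh.
apply: right_derivativeD; apply: right_derivative_sum => i.
  apply: (right_derivative_ext (f := fun y =>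
    capacity N i * (k y (tgt N i) * queue N (k y) i))) => [|y]; last by rewrite mulrA.
  apply: right_derivativeZ; apply: right_derivativeM; first exact: sh.
  exact: queue_right_derivative.
apply: right_derivativeZ.
have -> : 2 * k theta (val i) * p (val i) = p (val i) * k theta (val i) + k theta (val i) * p (val i) by ring.
by apply: (right_derivativeM (sh _) (sh _)).
Qed.

(** The derivative of the right-hand side in [theta] is [cut_functional p c], which is nonnegative
    for every direction [p]. *)
Lemma cut_growth c theta : 0 <= theta ->
  cut_functional N (k 0) c <=
  cut_functional N (k theta) c - total_inflow N * (theta * c (sink N)).
Proof.
move=> th0.
have /= := @moves_along_monotone (fun theta => cut_functional N (k theta) c
  - total_inflow N * (theta * c (sink N))) 0 _ _ _ 0 theta _ th0.
rewrite mul0r mulr0 subr0; apply => //.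
- rewrite /cut_functional; apply: locally_lipschitzB; last first.
    apply: locally_lipschitzZ; apply: locally_lipschitzM; first exact: locally_lipschitz_id.
    exact: locally_lipschitz_cst.
  apply: locally_lipschitzB; last exact: locally_lipschitz_cst.
  by apply: locally_lipschitzD; apply: locally_lipschitz_sum => i;
    (apply: locally_lipschitzM; last exact: locally_lipschitz_cst);
    apply: locally_lipschitzZ; exact: shift_lipschitz.
- move=> t p t0 mp; have [fl td _] := mp.
  have [x [_ rf _]] := thin_direction_regular HN fl td.
  have rz v (a : R) : right_derivative (fun t => a * k t v) t (a * p v).
    exact: right_derivativeZ (shift_right_derivative (v := v) mp).
  have rc v (a b : R) : right_derivative (fun t => a * k t v * b) t (a * p v * b).
    have := right_derivativeM (rz v a) (right_derivative_cst b t).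
    by rewrite mulr0 addr0.
  exists (cut_functional N p c); last exact: regular_cut_ge0 rf.
  have -> : cut_functional N p c =
    (\sum_e capacity N e * p (tgt N e) * Num.max (c (tgt N e) - c (src N e)) 0
     + \sum_(s : source N) inflow N (val s) * p (val s) * c (val s) - 0)
    - total_inflow N * (1 * c (sink N) + t * 0).
    by rewrite /cut_functional mulr0 addr0 mul1r subr0.
  apply: right_derivativeB.
    apply: right_derivativeB; last exact: right_derivative_cst.
    by apply: right_derivativeD; apply: right_derivative_sum => i; exact: rc.
  apply: right_derivativeZ; apply: right_derivativeM; first exact: right_derivative_id.
  exact: right_derivative_cst.
Qed.

End Shift.

Lemma shift_exists : exists C M, [/\ 0 <= M,
  forall theta v, 0 <= theta -> 1 <= ell theta v + C &
  forall theta v, 0 <= theta -> ell theta v + C <= M * (theta + 1)].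
Proof.
have [M M0 HM] := trajectory_growth.
pose S := \sum_v `|ell 0 v|.
have Sv v : `|ell 0 v| <= S.
  by rewrite /S (bigD1 v)//= lerDl sumr_ge0.
have S0 : 0 <= S by rewrite /S sumr_ge0.
(* Labels are nondecreasing and start above [- S], so [1 + S] lifts them to at least [1]. *)
exists (1 + S), (1 + 2 * S + M); split; first by lra.
- move=> theta v th0; have /andP[h1 h2] := HM v 0 theta (lexx _) th0.
  by have := Sv v; rewrite ler_norml => /andP[]; lra.
- move=> theta v th0; have /andP[h1 h2] := HM v 0 theta (lexx _) th0.
  have h3 : ell theta v + (1 + S) <= 1 + 2 * S + M * theta.
    by have := Sv v; rewrite ler_norml => /andP[]; lra.
  have h4 : 0 <= (1 + 2 * S) * theta by rewrite mulr_ge0//; lra.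
  by lra.
Qed.

Lemma energy_bound C M : 0 <= M ->
  (forall theta v, 0 <= theta -> 1 <= ell theta v + C) ->
  (forall theta v, 0 <= theta -> ell theta v + C <= M * (theta + 1)) ->
  exists D E0 : R, 0 <= D /\ forall theta, 0 <= theta ->
    energy N (fun v => ell theta v + C) (theta + 1) / (theta + 1) <=
    E0 + D * ln (theta + 1).
Proof.
move=> M0 k1 kM; pose k theta v := ell theta v + C.
pose D := \sum_e capacity N e * M * transit N e.
have D0 : 0 <= D.
  apply: sumr_ge0 => e _; apply: mulr_ge0; last exact: (transit_ge0 HN).
  by apply: mulr_ge0 => //; exact/ltW/(capacity_gt0 HN).
(* By [energy_rate_le] the quotient of energy and time grows at rate at most [D / (theta + 1)], so
   [f] is nondecreasing. *)
pose f theta := D * ln (theta + 1) - energy N (k theta) (theta + 1) * (theta + 1)^-1.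
exists D, (- f 0); split => // theta th0.
suff : f 0 <= f theta by rewrite /f; lra.
apply: (moves_along_monotone (a := 0)) => //.
  apply: locally_lipschitzB.
    by apply: locally_lipschitzZ; exact: locally_lipschitz_ln1D.
  apply: locally_lipschitzM; last exact: locally_lipschitz_inv1D.
  exact: energy_lipschitz.
move=> t p t0 mp; have [fl td _] := mp.
have [x [_ rf Bp]] := thin_direction_regular HN fl td.
have t1 : 0 < t + 1 by lra.
exists (D * (t + 1)^-1 - (energy_rate N (active_arcs N (ell t)) (resetting_arcs N (ell t))
   (k t) p (t + 1) * (t + 1)^-1 + energy N (k t) (t + 1) * (- (t + 1)^-1 ^+ 2))).
  apply: right_derivativeB.
    by apply: right_derivativeZ; exact: right_derivative_ln1D.
  apply: right_derivativeM; first exact: energy_right_derivative.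
  exact: right_derivative_inv1D.
have kpos v : 0 < k t v by apply: lt_le_trans (k1 t v t0); exact: ltr01.
have := @energy_rate_le R V E N HN (k t) p (fun e => x (inl e)) (t + 1) M t1 kpos
  (fun v => kM t v t0).
rewrite /k (active_shift C) (resetting_shift C) => /(_ rf Bp).
rewrite -/D -/(k t); set W := energy_rate _ _ _ _ _ _; set H := energy _ _ _ => h.
have -> : D * (t + 1)^-1 - (W * (t + 1)^-1 + H * - (t + 1)^-1 ^+ 2) =
  (H / (t + 1) + D - W) * (t + 1)^-1 by rewrite expr2; ring.
by rewrite mulr_ge0 ?invr_ge0 ?(ltW t1)// subr_ge0.
Qed.

End Trajectory.

Section Limits.
Variable R : realType.

Lemma right_derivative_unique (f : R -> R) x c d :
  right_derivative f x c -> right_derivative f x d -> c = d.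
Proof. exact: cvg_unique. Qed.

Lemma right_derivative_const (f : R -> R) x d : right_derivative f x d ->
  (forall y, x <= y -> f y = f x) -> d = 0.
Proof.
move=> fd fc; apply: right_derivative_unique fd _.
apply: right_derivative_near (right_derivative_cst (f x) x) => //.
near=> h; rewrite fc// lerDl ltW//.
Unshelve. all: by end_near. Qed.

Lemma cvg_le_limit (T : Type) (G : set_system T) (FG : ProperFilter G) (f : T -> R) (l a : R) :
  (f @ G --> l)%classic -> (forall b, a < b -> G (fun t => f t <= b)) -> l <= a.
Proof.
move=> fl fa; rewrite leNgt; apply/negP => al.
have h1 : a < (a + l) / 2 by lra.
have : \forall t \near G, (a + l) / 2 < f t.
  by apply: (cvgr_gt l) => //; lra.
move=> /(filterI (fa _ h1))/filter_ex[t [h2]].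
by rewrite ltNge h2.
Qed.

Lemma ln_le_sqrt (y : R) : 0 < y -> ln y <= 2 * Num.sqrt y.
Proof.
move=> y0; have s0 : 0 < Num.sqrt y by rewrite sqrtr_gt0.
have -> : ln y = ln (Num.sqrt y) *+ 2 by rewrite -lnXn// sqr_sqrtr// ltW.
by have := ln_leB1 s0; lra.
Qed.

End Limits.

(** * Convergence of average labels and arrival at steady state *)

Section LongRun.
Variables (R : realType) (V E : finType) (N : network R V E).
Hypothesis HN : network_axioms N.
Variable lam : V -> R.
Hypothesis Hlam : steady_state_direction N lam.
Variable ell : R -> V -> R.
Hypothesis Hell : equilibrium_trajectory N ell.
Implicit Types (e : E) (v w : V) (A B : {set E}) (p k c : V -> R) (theta : R).

Lemma cut_functional_scale k (th : R) c : 0 < th ->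
  th * cut_functional N (fun v => k v / th) c =
  cut_functional N k c - total_inflow N * ((th - 1) * c (sink N)).
Proof.
move=> th0; have kE v : th * (k v / th) = k v by rewrite mulrC divfK// gt_eqF.
rewrite /cut_functional mulrBr mulrDr !mulr_sumr.
have -> : \sum_e th * (capacity N e * (k (tgt N e) / th) * Num.max (c (tgt N e) - c (src N e)) 0)
  = \sum_e capacity N e * k (tgt N e) * Num.max (c (tgt N e) - c (src N e)) 0.
  by apply: eq_bigr => e _; rewrite -[k (tgt N e) in RHS]kE; ring.
have -> : \sum_(s : source N) th * (inflow N (val s) * (k (val s) / th) * c (val s))
  = \sum_(s : source N) inflow N (val s) * k (val s) * c (val s).
  by apply: eq_bigr => s _; rewrite -[k (val s) in RHS]kE; ring.
ring.
Qed.

(** The positive part of a label difference exceeds the queueing delay by at most the transit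
    time. *)
Lemma cut_functional_le_energy k (th M : R) : 0 < th -> (forall v, 0 <= k v) ->
  (forall v, k v <= M * th) ->
  th * cut_functional N (fun v => k v / th) (fun v => k v / th) <=
  energy N k th / th + \sum_e capacity N e * M * transit N e.
Proof.
move=> th0 k0 kM; have kE v : th * (k v / th) = k v by rewrite mulrC divfK// gt_eqF.
have -> : th * cut_functional N (fun v => k v / th) (fun v => k v / th) =
  \sum_e capacity N e * k (tgt N e) * Num.max (k (tgt N e) / th - k (src N e) / th) 0
  + \sum_(s : source N) inflow N (val s) * k (val s) ^+ 2 / th
  - total_inflow N * k (sink N).
  rewrite /cut_functional mulrBr mulrDr !mulr_sumr; congr (_ + _ - _).
  - apply: eq_bigr => e _; set mx := Num.max _ _.
    by rewrite -[in RHS](kE (tgt N e)); ring.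
  - by apply: eq_bigr => s _; field; rewrite gt_eqF.
  - by field; rewrite gt_eqF.
have -> : energy N k th / th =
  \sum_e capacity N e * k (tgt N e) * queue N k e / th
  + \sum_(s : source N) inflow N (val s) * k (val s) ^+ 2 / th
  - total_inflow N * k (sink N).
  rewrite /energy mulrBl mulrDl; congr (_ + _ - _); try by rewrite mulr_suml.
  by field; rewrite gt_eqF.
suff : \sum_e capacity N e * k (tgt N e) * Num.max (k (tgt N e) / th - k (src N e) / th) 0 <=
  \sum_e capacity N e * k (tgt N e) * queue N k e / th +
  \sum_e capacity N e * M * transit N e by lra.
rewrite -big_split; apply: ler_sum => e _ /=.
have t0 := transit_ge0 HN e.
have c0 := ltW (capacity_gt0 HN e).
have ck : 0 <= capacity N e * k (tgt N e) by rewrite mulr_ge0.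
rewrite -mulrBl -{1}[0](mul0r th^-1) -maxr_pMl ?invr_ge0 ?(ltW th0)// mulrA.
apply: (@le_trans _ _ (capacity N e * k (tgt N e) * (queue N k e + transit N e) / th)).
  rewrite ler_pM2r ?invr_gt0// ler_wpM2l//.
  by rewrite /queue maxC ge_max; apply/andP; split;
    [rewrite addr_ge0// le_max lexx ?orbT|rewrite -lerBlDr le_max lexx ?orbT].
rewrite mulrDr mulrDl lerD2l.
have -> : capacity N e * k (tgt N e) * transit N e / th =
  capacity N e * transit N e * (k (tgt N e) / th) by ring.
have -> : capacity N e * M * transit N e = capacity N e * transit N e * M by ring.
by rewrite ler_wpM2l ?mulr_ge0// ler_pdivrMr.
Qed.

(** Any accumulation point of the averages along [B] satisfies the conditions of [steady_unique].
    The set [B] is left free so that it can consist of supposed bad times. *)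
Lemma trajectory_average (B : R -> Prop) :
  (forall T, exists theta, T <= theta /\ B theta) ->
  (forall theta, B theta -> 0 <= theta) ->
  exists C, exists2 G : set_system R, ProperFilter G & G B /\
    forall v, ((fun theta => (ell theta v + C) / (theta + 1)) @ G --> lam v)%classic.
Proof.
move=> Bunb B0.
have [C [M [M0 k1 kM]]] := shift_exists HN Hell.
exists C; pose k theta v := ell theta v + C.
pose n theta v := k theta v / (theta + 1).
have n0 theta v : 0 <= theta -> 0 <= n theta v.
  move=> th0; rewrite /n divr_ge0//; last by lra.
  by apply: le_trans (k1 theta v th0); exact: ler01.
have nM theta v : B theta -> - M <= n theta v <= M.
  move=> /B0 th0; have := n0 theta v th0.
  have : n theta v <= M by rewrite /n ler_pdivrMr ?kM//; lra.
  by move=> h1 h2; rewrite h1 andbT; lra.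
have [G GF [GB GT [m nm]]] := bounded_cluster Bunb nM.
exists G => //; split => // v.
suff -> : lam v = m v by exact: nm.
symmetry; move: v.
have G0 : G (fun theta => 0 <= theta) by exact: GT.
apply: (steady_unique HN Hlam).
(* Dividing [cut_growth] by [theta + 1] bounds the functional below by a constant over
   [theta + 1]. *)
- move=> c; rewrite -oppr_le0.
  apply: (@cvg_le_limit R _ G GF (fun theta => - cut_functional N (n theta) c)).
    apply: cvgN; apply: (@cut_functional_cvg R V E N _ G GF n (fun=> c)) => // v.
    exact: cvg_cst.
  move=> b b0; pose K := `|cut_functional N (k 0) c|.
  apply: filterS (filterI G0 (GT (K / b))) => theta [th0 thK].
  have th1 : 0 < theta + 1 by lra.
  have := cut_growth HN Hell C c th0.
  have := cut_functional_scale (k theta) c th1; rewrite addrK -/(n theta) => <- h.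
  have : - K <= cut_functional N (k 0) c by rewrite /K lerNl -normrN ler_norm.
  have : K <= b * theta by rewrite mulrC -ler_pdivrMr.
  move=> h1 h2; rewrite -(ler_pM2l th1) mulrN.
  have -> : (theta + 1) * b = b * theta + b by ring.
  by lra.
- have [D [E0 [D0 HE]]] := energy_bound HN Hell M0 k1 kM.
  apply: (@cvg_le_limit R _ G GF (fun theta => cut_functional N (n theta) (n theta))).
    exact: cut_functional_cvg.
  move=> b b0; pose D1 := \sum_e capacity N e * M * transit N e.
  pose K := `|E0| + `|D1| + 2 * D.
  have K0 : 0 <= K by rewrite /K !addr_ge0// mulr_ge0.
  (* With [r] the square root of [theta + 1], the functional is at most [K / r], since the logarithm
     is at most [2 r]; this threshold makes [r] at least [2 K / b]. *)
  apply: filterS (filterI G0 (GT ((2 * K / b) ^+ 2))) => theta [th0 thK].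
  have th1 : 0 < theta + 1 by lra.
  have kpos v : 0 <= k theta v by apply: le_trans (k1 theta v th0); exact: ler01.
  have h1 := cut_functional_le_energy th1 kpos (fun v => kM theta v th0).
  have h2 := HE theta th0.
  have h3 := ln_le_sqrt th1.
  rewrite -/(n theta) -/D1 in h1.
  set r := Num.sqrt (theta + 1) in h3.
  have r1 : 1 <= r by rewrite -sqrtr1 ler_sqrt; lra.
  have rr : theta + 1 = r * r by rewrite -expr2 sqr_sqrtr// ltW.
  have rK : 2 * K / b <= r.
    have rK2 : (2 * K / b) ^+ 2 <= r ^+ 2.
      by rewrite [leRHS]expr2 -rr; apply: le_trans thK _; rewrite lerDl.
    by move: rK2; rewrite ler_pXn2r// nnegrE; [rewrite divr_ge0 ?mulr_ge0// ltW|lra].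
  have h4 : D * ln (theta + 1) <= D * (2 * r) by rewrite ler_wpM2l.
  have h5 : E0 + D1 <= (`|E0| + `|D1|) * r.
    apply: (@le_trans _ _ (`|E0| + `|D1|)); first by rewrite lerD// ler_norm.
    by rewrite ler_peMr// addr_ge0.
  have h6 : (theta + 1) * cut_functional N (n theta) (n theta) <= K * r.
    have -> : K * r = (`|E0| + `|D1|) * r + D * (2 * r) by rewrite /K; ring.
    by lra.
  have h7 : K <= b * r.
    have : 2 * K <= r * b by rewrite -ler_pdivrMr.
    by lra.
  rewrite -(ler_pM2l th1); apply: le_trans h6 _; rewrite rr.
  have -> : r * r * b = b * r * r by ring.
  by rewrite ler_wpM2r//; lra.
(* If [m] dropped on all arcs entering [Z], so would the labels at some time. No active arc could
   then enter [Z], although feasibility joins a source to [v0] by active arcs. *)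
- move=> Z [v0 v0Z] SZ; apply: contrapT => noarc.
  have dn e : src N e \notin Z -> tgt N e \in Z -> m (tgt N e) < m (src N e).
    by move=> h1 h2; rewrite ltNge; apply/negP => h3; apply: noarc; exists e.
  have : \forall theta \near G, forall e, src N e \notin Z -> tgt N e \in Z ->
      n theta (tgt N e) < n theta (src N e).
    apply: filter_forall => e.
    have [vZ|vZ] := boolP (src N e \in Z); first by apply: filterE.
    have [wZ|wZ] := boolP (tgt N e \in Z); last by apply: filterE.
    have hd := dn e vZ wZ; pose a := (m (tgt N e) + m (src N e)) / 2.
    have a1 : m (tgt N e) < a by rewrite /a; lra.
    have a2 : a < m (src N e) by rewrite /a; lra.
    have H1 : \forall t \near G, n t (tgt N e) < a by exact: (cvgr_lt (m (tgt N e))).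
    have H2 : \forall t \near G, a < n t (src N e) by exact: (cvgr_gt (m (src N e))).
    by apply: filterS (filterI H1 H2) => t [t1 t2] _ _; exact: lt_trans t2.
  move=> /(filterI G0)/filter_ex[theta [th0 H]].
  have th1 : 0 < theta + 1 by lra.
  have [s sS [q /andP[qw _]]] := feasible_reachable (trajectory_feasible Hell th0) v0.
  have : v0 \notin Z.
    apply: (walk_invariant (Q := fun v => v \notin Z) _ qw) => [e eA vZ|]; last exact: SZ.
    apply/negP => wZ; have := H e vZ wZ; rewrite /n ltr_pM2r ?invr_gt0//.
    move: eA; rewrite inE /k; have := transit_ge0 HN e; lra.
  by rewrite v0Z.
Qed.

(** Labels do not decrease along an active arc. If arcs going down in [lam] were active at
    arbitrarily late times, averages converging to [lam] along those times would give a
    contradiction. *)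
Lemma eventually_monotone : exists2 T, 0 <= T & forall theta, T <= theta ->
  forall e, e \in active_arcs N (ell theta) -> lam (src N e) <= lam (tgt N e).
Proof.
apply: contrapT => H.
pose B theta := 0 <= theta /\ exists2 e, e \in active_arcs N (ell theta) &
  lam (tgt N e) < lam (src N e).
have Bunb T : exists theta, T <= theta /\ B theta.
  apply: contrapT => HT; apply: H; exists (Num.max T 0); first by rewrite le_max lexx orbT.
  move=> theta; rewrite ge_max => /andP[Tth th0] e eA; rewrite leNgt; apply/negP => le.
  by apply: HT; exists theta; split => //; split => //; exists e.
have [C [G GF [GB Glim]]] := trajectory_average Bunb (fun _ h => proj1 h).
have : \forall theta \near G, forall e, lam (tgt N e) < lam (src N e) ->
    (ell theta (tgt N e) + C) / (theta + 1) < (ell theta (src N e) + C) / (theta + 1).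
  apply: filter_forall => e.
  have [hd|hd] := ltP (lam (tgt N e)) (lam (src N e)); last by apply: filterE.
  pose a := (lam (tgt N e) + lam (src N e)) / 2.
  have a1 : lam (tgt N e) < a by rewrite /a; lra.
  have a2 : a < lam (src N e) by rewrite /a; lra.
  pose n t v := (ell t v + C) / (t + 1).
  have nlam v : (n^~ v @ G --> lam v)%classic by exact: Glim.
  have H1 : \forall t \near G, n t (tgt N e) < a by exact: (cvgr_lt (lam (tgt N e))).
  have H2 : \forall t \near G, a < n t (src N e) by exact: (cvgr_gt (lam (src N e))).
  by apply: filterS (filterI H1 H2) => t [t1 t2] _; exact: lt_trans t2.
move=> /(filterI GB)/filter_ex[theta [[th0 [e eA le]] /(_ e le)]].
have th1 : 0 < theta + 1 by lra.
rewrite ltr_pM2r ?invr_gt0//; move: eA; rewrite inE; have := transit_ge0 HN e; lra.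
Qed.

Lemma potential_lipschitz : locally_lipschitz (fun theta => potential N lam (ell theta)).
Proof.
have el v := trajectory_lipschitz HN Hell v.
rewrite /potential; apply: locally_lipschitzB.
  apply: locally_lipschitzB; first exact: locally_lipschitzZ.
  by apply: locally_lipschitz_sum => s; exact: locally_lipschitzZ.
apply: locally_lipschitz_sum => e; apply: locally_lipschitzZ.
apply: locally_lipschitz_pos; apply: locally_lipschitzB; last exact: locally_lipschitz_cst.
exact: locally_lipschitzB.
Qed.

Lemma potential_right_derivative theta p : moves_along N ell theta p ->
  right_derivative (fun theta => potential N lam (ell theta)) theta
    (potential_rate N lam (active_arcs N (ell theta)) (resetting_arcs N (ell theta)) p).
Proof.
move=> [_ _ rd]; rewrite /potential /potential_rate; apply: right_derivativeB.
  apply: right_derivativeB; first exact: right_derivativeZ.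
  by apply: right_derivative_sum => s; exact: right_derivativeZ.
apply: right_derivative_sum => e; apply: right_derivativeZ.
rewrite -queue_rate_pos.
have H : right_derivative (fun theta => ell theta (tgt N e) - ell theta (src N e) - transit N e)
    theta (p (tgt N e) - p (src N e) - 0).
  apply: right_derivativeB; last exact: right_derivative_cst.
  exact: right_derivativeB.
rewrite subr0 in H; exact: right_derivative_pos H.
Qed.

Lemma trajectory_settles : exists2 T, 0 <= T & forall theta p, T <= theta ->
  moves_along N ell theta p -> forall v, p v = lam v.
Proof.
have [T T0 mono] := eventually_monotone.
pose rate theta p :=
  potential_rate N lam (active_arcs N (ell theta)) (resetting_arcs N (ell theta)) p.
have rate_ge0 theta p : T <= theta -> moves_along N ell theta p -> 0 <= rate theta p.
  move=> Tth [fl td _]; have [x [_ rf Bp]] := thin_direction_regular HN fl td.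
  apply: (potential_rate_ge0 HN Hlam rf Bp) => e xe.
  by apply: (mono _ Tth); exact: (regular_support rf).
(* Otherwise the potential would grow at rate at least [c] forever, against the duality bound. *)
have [theta0 [p0 [Tth0 mp0 r0]]] : exists theta0 p0,
    [/\ T <= theta0, moves_along N ell theta0 p0 & rate theta0 p0 <= 0].
  apply: contrapT => none.
  have [c c0 Hc] := potential_rate_gap N lam.
  pose f theta := potential N lam (ell theta) - c * theta.
  have fmono x y : T <= x -> x <= y -> f x <= f y.
    apply: (moves_along_monotone Hell (a := T)) => //.
      apply: locally_lipschitzB; first exact: potential_lipschitz.
      by apply: locally_lipschitzZ; exact: locally_lipschitz_id.
    move=> theta p Tth mp; exists (rate theta p - c * 1).
      apply: right_derivativeB; first exact: potential_right_derivative.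
      by apply: right_derivativeZ; exact: right_derivative_id.
    rewrite mulr1 subr_ge0; have [_ td _] := mp; apply: (Hc _ _ _ td).
    by rewrite ltNge; apply/negP => h; apply: none; exists theta, p.
  have [x _ rf] := steady_flow HN Hlam.
  pose K := \sum_e x (inl e) * transit N e.
  have pK theta : potential N lam (ell theta) <= K by exact: (potential_le _ rf).
  (* By this time growth at rate [c] would carry the potential to [K + c]. *)
  pose y := T + (K - potential N lam (ell T)) / c + 1.
  have d0 : 0 <= (K - potential N lam (ell T)) / c.
    by rewrite divr_ge0 ?(ltW c0)// subr_ge0.
  have Ty : T <= y by rewrite /y; lra.
  have := fmono T y (lexx _) Ty; have := pK y; rewrite /f.
  have -> : c * y = c * T + (K - potential N lam (ell T)) + c.
    by rewrite /y; field; rewrite gt_eqF.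
  by lra.
exists theta0 => [|theta p th0 mp]; first exact: le_trans Tth0.
have [fl0 td0 _] := mp0.
(* The potential is maximal at [theta0] and nondecreasing, hence constant afterwards, so its rate
   vanishes at all later times with a direction. *)
have pmax := potential_rate0_max HN Hlam fl0 td0 (mono _ Tth0) r0.
have pmono x y : T <= x -> x <= y ->
    potential N lam (ell x) <= potential N lam (ell y).
  apply: (moves_along_monotone Hell (f := fun t => potential N lam (ell t)) (a := T)) => //.
    exact: potential_lipschitz.
  move=> t q Tt mq; exists (rate t q); last exact: rate_ge0.
  exact: potential_right_derivative.
have pconst y : theta0 <= y -> potential N lam (ell y) = potential N lam (ell theta0).
  by move=> h; apply/eqP; rewrite eq_le pmax pmono.
have rd := potential_right_derivative mp.
have rate_eq0 : rate theta p = 0.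
  have cst y : theta <= y -> potential N lam (ell y) = potential N lam (ell theta).
    by move=> hy; rewrite pconst ?(le_trans th0)// pconst.
  exact: right_derivative_const rd cst.
have [fl td _] := mp.
apply: (potential_rate0_steady HN Hlam fl td).
  by apply: mono; exact: le_trans th0.
by rewrite -/(rate theta p) rate_eq0.
Qed.

End LongRun.

Theorem theorem7p2 (R : realType) (V E : finType) (N : network R V E)
    (HN : network_axioms N)
    (lam : V -> R) (Hlam : steady_state_direction N lam)
    (ell : R -> V -> R) (Hell : equilibrium_trajectory N ell) :
  exists2 T : R, 0 <= T &
    forall theta : R, T <= theta ->
      (forall v, derivable (ell^~ v) theta 1) ->
      forall v, derive1 (ell^~ v) theta = lam v.
Proof.
have [T T0 settled] := trajectory_settles HN Hlam Hell.
exists T => // theta Tth dl v.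
(* The direction is known only at almost every time; integrating shows that labels are affine after
   [T], which settles every point of differentiability. *)
have lin y : theta <= y -> ell y v - lam v * y = ell theta v - lam v * theta.
  move=> thy; apply/eqP; rewrite eq_le.
  (* The derivative is [0] for every factor [a]; the factors [1] and [-1] give the two
     inequalities. *)
  pose f (a : R) y := a * (ell y v - lam v * y).
  have mono a : f a theta <= f a y.
    apply: (moves_along_monotone Hell (a := T)) => //.
      apply: locally_lipschitzZ; apply: locally_lipschitzB.
        exact: (trajectory_lipschitz HN Hell).
      by apply: locally_lipschitzZ; exact: locally_lipschitz_id.
    move=> t p Tt mp; have [_ _ rd] := mp.
    exists (a * (p v - lam v * 1)); last by rewrite (settled t p Tt mp) mulr1 subrr mulr0.
    apply: right_derivativeZ; apply: right_derivativeB => //.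
    by apply: right_derivativeZ; exact: right_derivative_id.
  by have := mono 1; have := mono (-1); rewrite /f !mulN1r !mul1r lerN2 => -> ->.
have rd : right_derivative (fun y => ell y v - lam v * y) theta
    (derive1 (ell^~ v) theta - lam v * 1).
  apply: right_derivativeB; first exact: (derivable_right_derivative (dl v)).
  by apply: right_derivativeZ; exact: right_derivative_id.
by have := right_derivative_const rd lin; rewrite mulr1; lra.
Qed.
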